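(* Let $\Omega$ be a finite state space, let $\{u_k\}_{k\ge1}$ be a Markov chain on $\Omega$ generated by an irreducible transition matrix $P=[p(u,v)]_{u,v\in\Omega}$ with invariant distribution $\mu$, and let $\nu$ be the distribution of $u_1$. For $n\in\mathbb{N}_+$ let $R_n=[r_n(u,v)]_{u,v\in\Omega}$ with $r_n(u,v)=\frac1n\sum_{k=1}^n\mathbb{1}[(u_k,u_{k+1})=(u,v)]$. Then: (1) $R_n$ converges to $D_\mu P$ almost surely as $n\to\infty$. (2) For every $n\in\mathbb{N}_+$, every $t>0$ and all $u,v\in\Omega$, $$\mathbb{P}\left\{|r_n(u,v)-\mu(u)p(u,v)|\ge t\right\}\le 2\|\nu/\mu\|_\infty\exp\left(\frac{-n\,\gamma(P)\,t^2}{4\sqrt{(2+6\gamma(P))^2\mu_2(u,v)+t^2}}\right),$$ where $\mu_2(u,v)=\mu(u)p(u,v)$ and $\gamma(P)=\eta_p(P)/(1+\eta_p(P))$. (3) For every $n\in\mathbb{N}_+$, $$\mathbb{E}\left[\|R_n-D_\mu P\|_{\mathrm F}^2\right]\le\|\nu/\mu\|_\infty\min\left\{\frac{4+\eta_p(P)}{n\,\eta_p(P)},\ \frac{2+\eta_a(P)}{n\,\eta_a(P)}\right\}$$ (the second term in the minimum being $+\infty$ if $\eta_a(P)=0$). Moreover, if $P$ is reversible, $$\mathbb{E}\left[\|R_n-D_\mu P\|_{\mathrm F}^2\right]\le\|\nu/\mu\|_\infty\,\frac{2+\eta(P)}{n\,\eta(P)}.$$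
   Context: $|\Omega|\ge2$. $D_\mu$ is the diagonal matrix with diagonal $\mu$; $\|\cdot\|_{\mathrm F}$ is the Frobenius norm; $\|\nu/\mu\|_\infty=\max_u\nu(u)/\mu(u)$. $P$ acts on functions by $Ph(u)=\sum_vp(u,v)h(v)$. Let $\langle f,g\rangle_\mu=\sum_u\mu(u)f(u)g(u)$, $\|\cdot\|_\mu$ the associated norm, $L^0_{2,\mu}=\{h:\Omega\to\mathbb{R}:\sum_u\mu(u)h(u)=0\}$. The iterated Poincaré gap is $\eta_p(P)=\inf_{0\ne h\in L^0_{2,\mu}}\|(I-P)h\|_\mu/\|h\|_\mu$. The absolute spectral gap is $\eta_a(P)=1-\sup_{0\ne h\in L^0_{2,\mu}}\|Ph\|_\mu/\|h\|_\mu$. $P$ is reversible if $\mu(u)p(u,v)=\mu(v)p(v,u)$ for all $u,v$; then the spectral gap is $\eta(P)=1-\sup_{0\ne h\in L^0_{2,\mu}}\langle h,Ph\rangle_\mu/\|h\|_\mu^2$. *)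

(* Defs.v *)
From HB Require Import structures.
From mathcomp Require Import all_boot all_order all_algebra.
From mathcomp Require Import all_classical all_reals all_analysis.
Set Implicit Arguments.
Unset Strict Implicit.
Unset Printing Implicit Defensive.
Import Order.TTheory GRing.Theory Num.Theory.
Import numFieldNormedType.Exports.
Local Open Scope classical_set_scope.
Local Open Scope ring_scope.

Section Matrices.
Variables (R : realType) (Omega : finType).
Implicit Types (f p : Omega -> Omega -> R) (mu : Omega -> R).

(* Omega x Omega matrices are stored as ordinary square matrices, through the
   canonical enumeration of Omega. *)
Definition mx_of f : 'M[R]_#|Omega| :=
  \matrix_(i, j) f (enum_val i) (enum_val j).

Definition Dmx mu : 'M[R]_#|Omega| := diag_mx (\row_i mu (enum_val i)).

Definition frobenius m n (A : 'M[R]_(m, n)) : R :=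
  Num.sqrt (\sum_i \sum_j A i j ^+ 2).

Definition distribution_on mu : Prop :=
  (forall u, 0 <= mu u) /\ \sum_u mu u = 1.

Definition transition_matrix p : Prop := forall u, distribution_on (p u).

Definition irreducible_transition p : Prop :=
  forall i j : 'I_#|Omega|, exists k : nat, 0 < (mx_of p ^+ k) i j.

Definition invariant_distribution p mu : Prop :=
  distribution_on mu /\ forall v, \sum_u mu u * p u v = mu v.

Definition reversible_chain p mu : Prop :=
  forall u v, mu u * p u v = mu v * p v u.

(* max_u nu(u)/mu(u); the ratios are nonnegative for distributions, so the
   default value 0 of the iterated maximum is harmless. *)
Definition ratio_sup (nu mu : Omega -> R) : R :=
  \big[Num.max/0]_(u : Omega) (nu u / mu u).

End Matrices.

Section Gaps.
Variables (R : realType) (Omega : finType).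
Variables (p : Omega -> Omega -> R) (mu : Omega -> R).
Implicit Types (f g h : Omega -> R).

Definition markov_act h : Omega -> R := fun u => \sum_v p u v * h v.

Definition inner_mu f g : R := \sum_u mu u * f u * g u.

Definition norm_mu h : R := Num.sqrt (inner_mu h h).

Definition L20 : set (Omega -> R) := [set h | \sum_u mu u * h u = 0].

Definition poincare_gap : R :=
  inf [set norm_mu (h - markov_act h) / norm_mu h
          | h in L20 `\ (0 : Omega -> R)].

Definition absolute_gap : R :=
  1 - sup [set norm_mu (markov_act h) / norm_mu h
          | h in L20 `\ (0 : Omega -> R)].

(* The spectral gap; only meaningful for a reversible p. *)
Definition spectral_gap : R :=
  1 - sup [set inner_mu h (markov_act h) / norm_mu h ^+ 2
          | h in L20 `\ (0 : Omega -> R)].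

Definition gamma_gap : R := poincare_gap / (1 + poincare_gap).

End Gaps.

Section Chain.
Variables (d : measure_display) (T : measurableType d) (R : realType).
Variables (Pr : probability T R) (Omega : finType).
Implicit Types (u : nat -> T -> Omega) (p : Omega -> Omega -> R).

Definition cond_prob (A B : set T) : R :=
  fine (Pr (A `&` B)) / fine (Pr B).

Definition trajectory u (x : nat -> Omega) (k : nat) : set T :=
  [set w | forall i, (i <= k)%N -> u i w = x i].

(* Time is indexed from 0: u 0 is the initial state (u_1 in the one-based
   convention) and has distribution nu. *)
Definition markov_chain p (nu : Omega -> R) u : Prop :=
  [/\ forall k (A : set Omega), measurable (u k @^-1` A),
      forall x, Pr (u 0%N @^-1` [set x]) = (nu x)%:E
    & forall (x : nat -> Omega) (k : nat),
        Pr (trajectory u x k) != 0%E ->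
        cond_prob (u k.+1 @^-1` [set x k.+1]) (trajectory u x k)
        = p (x k) (x k.+1)].

Definition pair_freq u (n : nat) (w : T) (a b : Omega) : R :=
  n%:R^-1 * \sum_(k < n) ((u k w, u k.+1 w) == (a, b))%:R.

End Chain.

(* Main.v *)
Require Import Defs.
From HB Require Import structures.
From mathcomp Require Import all_boot all_order all_algebra.
From mathcomp Require Import all_classical all_reals all_analysis.
From mathcomp Require Import measurable_realfun ring lra.
Set Implicit Arguments.
Unset Strict Implicit.
Unset Printing Implicit Defensive.
Import Order.TTheory GRing.Theory Num.Theory.
Import numFieldNormedType.Exports.
Local Open Scope classical_set_scope.
Local Open Scope ring_scope.

(** Let [f] solve [f - Pf = h] with [mu(f) = mu(h) = 0]; the Poincare gap bounds
    [|f|] by [|h| / eta_p].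

    Mean square error.  Centred at its mean, the number of crossings of [(a, b)]
    has second moment
      [n (m - m^2) + 2 m p(a, b) (sum_(k < n) sum_(l < k) P^l 1_a^0)(b)],
    where [m = mu(a) p(a, b)] and [1_a^0] is [1_a] minus its mean, so that only the
    norm of the double sum on [L20] matters: it is at most [2 n / eta_p] by
    telescoping, [n / eta_a] by a geometric series, and [n / eta] for a reversible
    [P], where the double sum is a nonnegative self-adjoint operator.

    Deviations.  The crossings of [(a, b)] are renewal times.  For the upper tail
    take [z = 1 + d] and [(z - P) f = 1_a]; with [y = p(a, b) f(b)] the time [s]
    between crossings has [E z^-s = y / (1 + y)], and [y <= m / d + 1 / eta_p].
    For the lower tail take [z = 1 - d] and [(P - z) u = 1_a]; with
    [Y = p(a, b) u(b) >= m / d - 1 / (eta_p - d)] one has [E z^-s = Y / (Y - 1)].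
    The choices [d = gamma t / 2] and [d = gamma t / 4] give the exponent.  There
    is nothing to prove when the exponential factor of the claimed bound is at
    least [1 / 2]; otherwise [n gamma t > 2], which absorbs all prefactors.

    Almost sure convergence follows from the deviation bound by Borel-Cantelli. *)

(** Serves twice: Cauchy-Schwarz for [inner_mu], and for the form in [double_sum_reversible], which
    may be degenerate; hence [b = 0] is allowed. *)
Lemma quadratic_ge0_disc (R : realType) (a b c : R) : 0 <= b ->
  (forall s, 0 <= a + 2 * s * c + s ^+ 2 * b) -> c ^+ 2 <= a * b.
Proof.
rewrite le_eqVlt => /predU1P[<- H|b0 H].
- rewrite mulr0; have [->|c0] := eqVneq c 0; first by rewrite expr0n.
  have := H (- (a + 1) / (2 * c)).
  have -> : a + 2 * (- (a + 1) / (2 * c)) * c + (- (a + 1) / (2 * c)) ^+ 2 * 0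
    = - 1 by field; rewrite c0.
  by rewrite ler0N1.
- have := H (- (c / b)).
  have -> : a + 2 * (- (c / b)) * c + (- (c / b)) ^+ 2 * b = a - c ^+ 2 / b.
    by field; rewrite gt_eqF.
  by rewrite subr_ge0 ler_pdivrMr.
Qed.

(** * Kernels and the weighted inner product *)

Section Kernels.
Variables (R : realType) (Omega : finType).
Implicit Types (K : Omega -> Omega -> R) (f g h : Omega -> R).

Lemma markov_actD K f g :
  markov_act K (f + g) = markov_act K f + markov_act K g.
Proof.
apply/funext => u; rewrite [in RHS]fctE -big_split /=.
by apply: eq_bigr => v _; rewrite fctE mulrDr.
Qed.

Lemma markov_actN K f : markov_act K (- f) = - markov_act K f.
Proof.
apply/funext => u; rewrite [in RHS]fctE -sumrN.
by apply: eq_bigr => v _; rewrite fctE mulrN.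
Qed.

Lemma markov_actB K f g :
  markov_act K (f - g) = markov_act K f - markov_act K g.
Proof. by rewrite markov_actD markov_actN. Qed.

(** An injective endomorphism of a finite-dimensional space is bijective. The inverse matrix is
    returned as a kernel, so that it acts through [markov_act] again. *)
Lemma inverse_kernel K :
  (forall h, markov_act K h = 0 -> h = 0) ->
  exists J, cancel (markov_act K) (markov_act J) /\
            cancel (markov_act J) (markov_act K).
Proof.
move=> injK; pose A : 'M[R]_#|Omega| := mx_of K.
have uA : A \in unitmx.
  rewrite -unitmx_tr -row_free_unit; apply: inj_row_free => v vA.
  have /injK h0 : markov_act K (fun u => v ord0 (enum_rank u)) = 0.
    apply/funext => u; rewrite /markov_act.
    have /matrixP/(_ ord0 (enum_rank u)) := vA; rewrite !mxE; apply: etrans.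
    rewrite (reindex (@enum_val _ Omega)) /=; last exact: onW_bij (@enum_val_bij Omega).
    by apply: eq_bigr => j _; rewrite !mxE enum_valK enum_rankK mulrC.
  apply/rowP => j; rewrite mxE.
  by have := congr1 (fun h => h (enum_val j)) h0; rewrite enum_valK.
pose J u v := invmx A (enum_rank u) (enum_rank v).
have can_mx (B C : 'M[R]_#|Omega|) : B *m C = 1%:M ->
    cancel (markov_act (fun u v => C (enum_rank u) (enum_rank v)))
           (markov_act (fun u v => B (enum_rank u) (enum_rank v))).
  move=> BC h; apply/funext => u; rewrite /markov_act.
  under eq_bigr do rewrite mulr_sumr.
  rewrite exchange_big /=.
  have BCE v : \sum_w B (enum_rank u) (enum_rank w) *
        C (enum_rank w) (enum_rank v)
      = (u == v)%:R.
    have /matrixP/(_ (enum_rank u) (enum_rank v)) := BC.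
    rewrite !mxE (inj_eq enum_rank_inj) => <-.
    rewrite (reindex (@enum_val _ Omega)) /=; last exact: onW_bij (@enum_val_bij Omega).
    by apply: eq_bigr => w _; rewrite enum_valK.
  under eq_bigr => v _.
    under eq_bigr do rewrite mulrA.
    rewrite -mulr_suml BCE; over.
  rewrite (bigD1 u) //= eqxx mul1r big1 ?addr0 // => v.
  by rewrite eq_sym => /negPf ->; rewrite mul0r.
have KE : K = fun u v => A (enum_rank u) (enum_rank v).
  by apply/funext => u; apply/funext => v; rewrite mxE !enum_rankK.
exists J; rewrite KE; split; apply: can_mx; first exact: mulVmx.
exact: mulmxV.
Qed.

End Kernels.

Section Inner.
Variables (R : realType) (Omega : finType) (mu : Omega -> R).
Hypothesis mu_ge0 : forall u, 0 <= mu u.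
Implicit Types (f g h : Omega -> R).
Local Notation ip := (inner_mu mu).
Local Notation nm := (norm_mu mu).

Definition mean h := \sum_u mu u * h u.

Definition atom (a : Omega) : Omega -> R := fun x => (x == a)%:R.

Lemma innerC f g : ip f g = ip g f.
Proof. by apply: eq_bigr => u _; rewrite -!mulrA (mulrC (f u)). Qed.

Lemma innerDl f g h : ip (f + g) h = ip f h + ip g h.
Proof.
by rewrite -big_split; apply: eq_bigr => u _; rewrite fctE mulrDr mulrDl.
Qed.

Lemma innerNl f h : ip (- f) h = - ip f h.
Proof.
by rewrite -sumrN; apply: eq_bigr => u _; rewrite fctE mulrN mulNr.
Qed.

Lemma innerZl c f h : ip (c *: f) h = c * ip f h.
Proof.
rewrite mulr_sumr; apply: eq_bigr => u _; rewrite fctE /GRing.scale /=; ring.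
Qed.

Lemma innerBl f g h : ip (f - g) h = ip f h - ip g h.
Proof. by rewrite innerDl innerNl. Qed.

Lemma innerDr f g h : ip h (f + g) = ip h f + ip h g.
Proof. by rewrite innerC innerDl (innerC f) (innerC g). Qed.

Lemma innerNr f h : ip h (- f) = - ip h f.
Proof. by rewrite innerC innerNl innerC. Qed.

Lemma innerBr f g h : ip h (f - g) = ip h f - ip h g.
Proof. by rewrite innerDr innerNr. Qed.

Lemma innerZr c f h : ip h (c *: f) = c * ip h f.
Proof. by rewrite innerC innerZl innerC. Qed.

Lemma inner_ge0 f : 0 <= ip f f.
Proof. by apply: sumr_ge0 => u _; rewrite -mulrA mulr_ge0 // -expr2 sqr_ge0. Qed.

Lemma norm_ge0 f : 0 <= nm f. Proof. exact: sqrtr_ge0. Qed.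

Lemma norm_sqr f : nm f ^+ 2 = ip f f.
Proof. by rewrite sqr_sqrtr // inner_ge0. Qed.

Lemma inner_le_norm f g : ip f g <= nm f * nm g.
Proof.
have : ip f g ^+ 2 <= (nm f * nm g) ^+ 2.
  rewrite exprMn !norm_sqr; apply: quadratic_ge0_disc => [|s].
    exact: inner_ge0.
  have := inner_ge0 (f + s *: g).
  rewrite innerDl !innerDr !innerZl !innerZr (innerC g f).
  by congr (_ <= _); ring.
have : 0 <= nm f * nm g by rewrite mulr_ge0 ?norm_ge0.
case: (lerP (ip f g) 0) => [fg0 ? _|fg0 N0]; first exact: le_trans fg0 _.
by rewrite ler_sqr ?nnegrE // ltW.
Qed.

Lemma norm_le f g : ip f f <= ip g g -> nm f <= nm g.
Proof. by move=> fg; rewrite ler_sqrt // inner_ge0. Qed.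

Lemma norm_leM f g c : 0 <= c -> ip f f <= c ^+ 2 * ip g g -> nm f <= c * nm g.
Proof.
move=> c0; rewrite -!norm_sqr -exprMn ler_sqr // ?nnegrE ?norm_ge0 //.
by rewrite mulr_ge0 ?norm_ge0.
Qed.

Lemma normN f : nm (- f) = nm f.
Proof. by rewrite /norm_mu innerNl innerNr opprK. Qed.

Lemma normD f g : nm (f + g) <= nm f + nm g.
Proof.
rewrite -ler_sqr ?nnegrE ?addr_ge0 ?norm_ge0 // norm_sqr sqrrD !norm_sqr.
rewrite innerDl !innerDr (innerC g f).
have := inner_le_norm f g; rewrite -mulr_natl; lra.
Qed.

Lemma normZ c f : nm (c *: f) = `|c| * nm f.
Proof.
rewrite /norm_mu innerZl innerZr mulrA -expr2.
by rewrite sqrtrM ?sqr_ge0 // sqrtr_sqr.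
Qed.

Lemma norm0 : nm 0 = 0.
Proof. by rewrite /norm_mu /inner_mu big1 ?sqrtr0 // => u _; rewrite mulr0. Qed.

Lemma sum_atom (F : Omega -> R) a : \sum_u F u * atom a u = F a.
Proof.
rewrite (bigD1 a) //= /atom eqxx mulr1 big1 ?addr0 // => u /negPf ->.
by rewrite mulr0.
Qed.

Lemma inner_atom a f : ip (atom a) f = mu a * f a.
Proof.
rewrite -[RHS](sum_atom (fun u => mu u * f u)); apply: eq_bigr => u _; ring.
Qed.

Lemma norm_atom a : nm (atom a) = Num.sqrt (mu a).
Proof. by rewrite /norm_mu inner_atom /atom eqxx mulr1. Qed.

Lemma meanD f g : mean (f + g) = mean f + mean g.
Proof. by rewrite -big_split; apply: eq_bigr => u _; rewrite fctE mulrDr. Qed.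

Lemma meanN f : mean (- f) = - mean f.
Proof. by rewrite -sumrN; apply: eq_bigr => u _; rewrite fctE mulrN. Qed.

Lemma meanB f g : mean (f - g) = mean f - mean g.
Proof. by rewrite meanD meanN. Qed.

Lemma meanZ c f : mean (c *: f) = c * mean f.
Proof. by rewrite mulr_sumr; apply: eq_bigr => u _; rewrite fctE mulrCA. Qed.

Lemma mean_atom a : mean (atom a) = mu a.
Proof. exact: sum_atom. Qed.

Hypothesis mu_sum1 : \sum_u mu u = 1.

Lemma mean_cst c : mean (cst c) = c.
Proof. by rewrite /mean -mulr_suml mu_sum1 mul1r. Qed.

Definition centered h := h - cst (mean h).

Lemma mean_centered h : mean (centered h) = 0.
Proof. by rewrite meanB mean_cst subrr. Qed.

Lemma inner_centered h g : mean g = 0 -> ip (centered h) g = ip h g.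
Proof.
move=> g0; rewrite innerBl [X in _ - X](_ : _ = mean h * mean g).
  by rewrite g0 mulr0 subr0.
by rewrite mulr_sumr; apply: eq_bigr => u _; rewrite mulrAC mulrC.
Qed.

(** [centered] is an orthogonal projection: [|centered h|^2 = <h, centered h>], and Cauchy-Schwarz
    applies. *)
Lemma norm_centered h : nm (centered h) <= nm h.
Proof.
have := inner_le_norm h (centered h).
rewrite -inner_centered ?mean_centered // -norm_sqr expr2.
have := norm_ge0 (centered h); rewrite le_eqVlt => /predU1P[<- _|n0].
  exact: norm_ge0.
by rewrite ler_pM2r.
Qed.

Hypothesis mu_gt0 : forall u, 0 < mu u.

Lemma norm_gt0 h : h != 0 -> 0 < nm h.
Proof.
move=> h0; rewrite sqrtr_gt0 lt_neqAle inner_ge0 andbT eq_sym.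
apply: contra_neq h0 => /eqP; rewrite psumr_eq0 => [/allP H|u _]; last first.
  by rewrite -mulrA mulr_ge0 // -expr2 sqr_ge0.
apply/funext => u; have := H u (mem_index_enum u); rewrite -mulrA -expr2.
by rewrite mulf_eq0 gt_eqF //= sqrf_eq0 => /eqP.
Qed.

End Inner.

(** * Contraction, irreducibility and maximum principles *)

Section Invariant.
Variables (R : realType) (Omega : finType).
Variables (p : Omega -> Omega -> R) (mu : Omega -> R).
Hypotheses (hp : transition_matrix p) (hmu : invariant_distribution p mu).
Implicit Types (f g h : Omega -> R).
Local Notation ip := (inner_mu mu).
Local Notation nm := (norm_mu mu).
Local Notation P := (markov_act p).

Let p_ge0 u v : 0 <= p u v. Proof. by case: (hp u). Qed.
Let p_sum1 u : \sum_v p u v = 1. Proof. by case: (hp u). Qed.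
Let mu_ge0 u : 0 <= mu u. Proof. by case: hmu => -[]. Qed.
Let mu_sum1 : \sum_u mu u = 1. Proof. by case: hmu => -[]. Qed.

Lemma distribution_le1 (q : Omega -> R) a : distribution_on q -> q a <= 1.
Proof.
move=> [q0 <-]; rewrite (bigD1 a) //= lerDl; apply: sumr_ge0 => v _; exact: q0.
Qed.

Lemma transition_le1 u v : p u v <= 1. Proof. exact: distribution_le1. Qed.

Lemma mean_markov h : mean mu (P h) = mean mu h.
Proof.
rewrite /mean /markov_act; under eq_bigr do rewrite mulr_sumr.
rewrite exchange_big; apply: eq_bigr => v _.
under eq_bigr do rewrite mulrA; by rewrite -mulr_suml hmu.2.
Qed.

Lemma markov_cst c : P (cst c) = cst c.
Proof. by apply/funext => u; rewrite /markov_act -mulr_suml p_sum1 mul1r. Qed.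

(** Jensen's inequality in each row, whose defect is the variance of [h] under [p u]; invariance
    then removes [P] from the mean. *)
Lemma inner_markov_le h : ip (P h) (P h) <= ip h h.
Proof.
have jensen u : P h u ^+ 2 <= P (fun v => h v ^+ 2) u.
  rewrite -subr_ge0.
  have -> : P (fun v => h v ^+ 2) u - P h u ^+ 2 =
      \sum_v p u v * (h v - P h u) ^+ 2.
    under eq_bigr do rewrite sqrrB mulrDr mulrBr.
    rewrite big_split /= sumrB -mulr_suml p_sum1 mul1r.
    rewrite -[X in _ = _ - X + _]/(\sum_i p u i * (h i * P h u *+ 2)).
    under [X in _ = _ - X + _]eq_bigr do rewrite -mulrnAr mulrA.
    rewrite -mulr_suml -[\sum_i p u i * h i]/(P h u) -mulr_natl /markov_act.
    ring.
  by apply: sumr_ge0 => v _; rewrite mulr_ge0 ?sqr_ge0.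
apply: le_trans (_ : mean mu (P (fun v => h v ^+ 2)) <= _).
  by apply: ler_sum => u _; rewrite -mulrA -expr2 ler_wpM2l.
rewrite mean_markov le_eqVlt; apply/orP; left; apply/eqP.
by apply: eq_bigr => u _; rewrite -mulrA -expr2.
Qed.

Lemma norm_markov_le h : nm (P h) <= nm h.
Proof. by apply: norm_le => //; exact: inner_markov_le. Qed.

Lemma norm_iter_markov_le k h : nm (iter k P h) <= nm h.
Proof.
by elim: k => //= k IH; apply: le_trans (norm_markov_le _) IH.
Qed.

Lemma mean_iter_markov k h : mean mu (iter k P h) = mean mu h.
Proof. by elim: k => //= k <-; rewrite mean_markov. Qed.

(** After expansion this is [|Pg| <= |g|]: the operator [I - P] is accretive, with a quantitative
    bound. *)
Lemma inner_subP_ge g : ip (g - P g) (g - P g) <= 2 * ip g (g - P g).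
Proof.
have := inner_markov_le g.
rewrite innerBl // !innerBr // (innerC mu (P g) g); lra.
Qed.

Lemma inner_subP_ge0 g : 0 <= ip g (g - P g).
Proof. have := inner_subP_ge g; have := inner_ge0 mu_ge0 (g - P g); lra. Qed.

Section Irreducible.
Hypothesis hirr : irreducible_transition p.

(** By induction on [k], the entries of [P^k] from [x] to states outside [S] vanish. All uses of
    irreducibility go through this form. *)
Lemma irreducible_closed (S : pred Omega) x :
  x \in S -> (forall u v, u \in S -> 0 < p u v -> v \in S) -> forall y, y \in S.
Proof.
move=> xS clS y; apply/negPn/negP => yS.
have [k] := hirr (enum_rank x) (enum_rank y).
suff -> : (mx_of p ^+ k) (enum_rank x) (enum_rank y) = 0 by rewrite ltxx.
move: y yS; elim: k => [|k IH] y yS.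
  rewrite expr0 mxE (inj_eq enum_rank_inj).
  by case: eqP xS => // ->; rewrite (negPf yS).
rewrite exprSr mxE big1 // => j _; rewrite mxE enum_rankK.
case: (boolP (enum_val j \in S)) => jS; last first.
  by rewrite -[j]enum_valK IH ?mul0r // enum_valK.
have := p_ge0 (enum_val j) y; rewrite le_eqVlt => /predU1P[<-|].
  by rewrite mulr0.
by move=> /(clS _ _ jS); rewrite (negPf yS).
Qed.

(** The support of [mu] is nonempty and closed under transitions. *)
Lemma invariant_gt0 u : 0 < mu u.
Proof.
have [x mux] : exists x, 0 < mu x.
  apply/not_existsP => mu0.
  have := mu_sum1; rewrite big1 => [|x _]; first by move/esym/eqP; rewrite oner_eq0.
  by apply/eqP; have := mu_ge0 x; rewrite le_eqVlt => /predU1P[|/(mu0 x)] // ->.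
apply: (irreducible_closed (S := [pred v | 0 < mu v]) (x := x)) => //= v w.
rewrite !inE => muv pvw; rewrite -hmu.2 (bigD1 v) //= ltr_pwDl ?mulr_gt0 //.
by apply: sumr_ge0 => i _; rewrite mulr_ge0.
Qed.

(** Maximum principle: at a maximiser [h] is an average of values that do not exceed it, so the
    maximisers form a closed set. *)
Lemma harmonic_constant h : P h = h -> forall x y, h x = h y.
Proof.
move=> hh x0.
pose m := [arg max_(i > x0) h i]%O.
have mP y : h y <= h m by rewrite /m; case: arg_maxP => //= i _ /(_ y isT).
suff hm y : h y = h m by move=> y; rewrite !hm.
apply/eqP; apply: (irreducible_closed (S := [pred v | h v == h m]) (x := m)).
  by rewrite inE.
move=> u v; rewrite !inE => /eqP hu puv.
have : \sum_w p u w * (h m - h w) = 0.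
  under eq_bigr do rewrite mulrBr.
  rewrite sumrB -mulr_suml p_sum1 mul1r -[X in _ - X]/(P h u) hh hu subrr //.
move/eqP; rewrite psumr_eq0 => [/allP/(_ v (mem_index_enum v))|w _]; last first.
  by rewrite mulr_ge0 // subr_ge0.
by rewrite mulf_eq0 gt_eqF //= subr_eq0 eq_sym.
Qed.

(* A zero would propagate along transitions until the chain reaches [a]. *)
Lemma nonneg_gt0 f a : (forall x, 0 <= f x) -> 0 < f a ->
  (forall x, x != a -> f x = 0 -> P f x = 0) -> forall x, 0 < f x.
Proof.
move=> f0 fa fP x; rewrite lt_neqAle f0 andbT eq_sym.
apply/negP => /eqP fx.
suff : a \in [pred v | f v == 0] by rewrite inE gt_eqF.
apply: (irreducible_closed (x := x)); first by rewrite inE fx.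
move=> u v; rewrite !inE => /eqP fu puv.
have ua : u != a by apply: contraTneq fa => <-; rewrite fu ltxx.
have /eqP := fP u ua fu; rewrite /markov_act psumr_eq0 => [|w _]; last first.
  by rewrite mulr_ge0.
by move=> /allP/(_ v (mem_index_enum v)); rewrite mulf_eq0 gt_eqF.
Qed.

End Irreducible.

End Invariant.

(** * Gaps *)

Section Gap.
Variables (R : realType) (Omega : finType).
Variables (p : Omega -> Omega -> R) (mu : Omega -> R).
Hypotheses (hp : transition_matrix p) (hmu : invariant_distribution p mu).
Hypothesis hirr : irreducible_transition p.
Implicit Types (f g h : Omega -> R).
Local Notation ip := (inner_mu mu).
Local Notation nm := (norm_mu mu).
Local Notation P := (markov_act p).

Let mu_gt0 u : 0 < mu u. Proof. exact: (invariant_gt0 hp hmu hirr). Qed.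
Let mu_ge0 u : 0 <= mu u. Proof. exact: ltW. Qed.
Let mu_sum1 : \sum_u mu u = 1. Proof. by case: hmu => -[]. Qed.

Lemma poincare_gap_le h : mean mu h = 0 ->
  poincare_gap p mu * nm h <= nm (h - P h).
Proof.
move=> h0; have [->|hn0] := eqVneq h 0.
  by rewrite norm0 mulr0 norm_ge0.
rewrite -ler_pdivlMr ?norm_gt0 //; apply: ge_inf.
  by exists 0 => _ [g _ <-]; rewrite divr_ge0 ?norm_ge0.
by exists h => //; split => //= /eqP; rewrite (negPf hn0).
Qed.

Lemma absolute_gap_has_sup :
  has_ubound [set nm (P h) / nm h | h in L20 mu `\ (0 : Omega -> R)].
Proof.
exists 1 => _ [g [_ /eqP gn0] <-].
by rewrite ler_pdivrMr ?norm_gt0 // mul1r norm_markov_le.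
Qed.

Lemma absolute_gap_le h : mean mu h = 0 ->
  nm (P h) <= (1 - absolute_gap p mu) * nm h.
Proof.
move=> h0; have [->|hn0] := eqVneq h 0.
  by rewrite norm0 mulr0 -(norm0 mu) norm_markov_le.
rewrite -ler_pdivrMr ?norm_gt0 // subKr; apply: ub_le_sup.
  exact: absolute_gap_has_sup.
by exists h => //; split => //= /eqP; rewrite (negPf hn0).
Qed.

Lemma spectral_gap_has_sup :
  has_ubound [set ip h (P h) / nm h ^+ 2 | h in L20 mu `\ (0 : Omega -> R)].
Proof.
exists 1 => _ [g [_ /eqP gn0] <-].
rewrite ler_pdivrMr ?exprn_gt0 ?norm_gt0 // mul1r expr2.
apply: le_trans (inner_le_norm mu_ge0 _ _) _.
by rewrite ler_wpM2l ?norm_ge0 ?norm_markov_le.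
Qed.

Lemma spectral_gap_le h : mean mu h = 0 ->
  spectral_gap p mu * ip h h <= ip h (h - P h).
Proof.
move=> h0; have [->|hn0] := eqVneq h 0.
  by rewrite /inner_mu !big1 ?mulr0 // => u _; rewrite mulr0 ?mul0r.
have : ip h (P h) / nm h ^+ 2 <= 1 - spectral_gap p mu.
  rewrite subKr; apply: ub_le_sup; first exact: spectral_gap_has_sup.
  by exists h => //; split => //= /eqP; rewrite (negPf hn0).
rewrite ler_pdivrMr ?exprn_gt0 ?norm_gt0 // norm_sqr // innerBr; lra.
Qed.

(** The kernel of [I - P + 1 mu], whose inverse is the fundamental matrix of Kemeny and Snell. It
    agrees with [I - P] on mean-zero functions and is injective on all functions. *)
Let fundamental u v : R := (u == v)%:R - p u v + mu v.

Let fundamentalE h : markov_act fundamental h = h - P h + cst (mean mu h).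
Proof.
apply/funext => u; rewrite /markov_act !fctE /mean.
under eq_bigr do rewrite mulrDl mulrBl.
rewrite big_split sumrB /=; congr (_ - _ + _).
rewrite -[RHS](sum_atom h); apply: eq_bigr => v _.
by rewrite mulrC /atom eq_sym.
Qed.

Let fundamental_inverse : exists J, cancel (markov_act fundamental) (markov_act J) /\
  cancel (markov_act J) (markov_act fundamental).
Proof.
apply: inverse_kernel => h Kh.
have h0 : mean mu h = 0.
  have := congr1 (mean mu) Kh.
  rewrite fundamentalE meanD meanB mean_markov // subrr add0r mean_cst // => ->.
  by rewrite /mean big1 // => u _; exact: mulr0.
have hP : P h = h.
  apply/esym/eqP; rewrite -subr_eq0; apply/eqP.
  rewrite -[RHS]Kh fundamentalE h0; apply/funext => u; rewrite !fctE.
  by rewrite addr0.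
apply/funext => u; transitivity (mean mu h); last by rewrite h0.
rewrite -[LHS](mean_cst mu_sum1).
by apply: eq_bigr => v _; congr (_ * _); exact: (harmonic_constant hp hirr hP).
Qed.

Lemma poisson_solution f : mean mu f = 0 ->
  exists2 g, mean mu g = 0 & g - P g = f.
Proof.
move=> f0; have [J [_ JK]] := fundamental_inverse.
have := JK f; set g := markov_act J f; rewrite fundamentalE => gE.
have g0 : mean mu g = 0.
  have := congr1 (mean mu) gE.
  by rewrite meanD meanB mean_markov // subrr add0r mean_cst // f0.
by exists g => //; rewrite -gE g0; apply/funext => u; rewrite !fctE addr0.
Qed.

(** Keeps the infimum in [poincare_gap] away from 0. Each [h u] is an inner product of [h - P h]
    with a row of [J], so Cauchy-Schwarz bounds [|h|] by the Hilbert-Schmidt norm of [J]. *)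
Lemma poincare_inequality : exists2 c, 0 < c &
  forall h, mean mu h = 0 -> c * nm h <= nm (h - P h).
Proof.
have [J [KJ _]] := fundamental_inverse.
(* Division by [mu v] turns the plain sum of [markov_act J] into [inner_mu]; the summand 1 below
   only keeps [C] positive. *)
pose q u v := J u v / mu v.
pose C := 1 + \sum_u mu u * ip (q u) (q u).
have C0 : 0 < C.
  by rewrite ltr_wpDr // sumr_ge0 // => u _; rewrite mulr_ge0 // inner_ge0.
have sC0 : 0 < Num.sqrt C by rewrite sqrtr_gt0.
exists (Num.sqrt C)^-1; first by rewrite invr_gt0.
move=> h h0; rewrite mulrC ler_pdivrMr // mulrC.
apply: norm_leM => //.
rewrite (sqr_sqrtr (ltW C0)).
set d := h - P h.
have hE u : h u = ip (q u) d.
  have -> : h u = markov_act J (markov_act fundamental h) u by rewrite KJ.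
  rewrite fundamentalE h0 /inner_mu /markov_act; apply: eq_bigr => v _.
  rewrite -/d; have -> : (d + cst 0) v = d v by rewrite !fctE addr0.
  by rewrite /q; field; rewrite gt_eqF.
apply: le_trans (_ : (\sum_u mu u * ip (q u) (q u)) * ip d d <= _).
  rewrite mulr_suml; apply: ler_sum => u _.
  rewrite -!mulrA ler_wpM2l // -expr2 {1}hE.
  rewrite -!norm_sqr // -exprMn -[X in X <= _]real_normK ?num_real //.
  rewrite ler_sqr ?nnegrE ?mulr_ge0 ?norm_ge0 // ler_norml inner_le_norm // andbT.
  by rewrite lerNl -innerNl -(normN _ (q u)) inner_le_norm.
by rewrite ler_wpM2r ?inner_ge0 // lerDr.
Qed.

Hypothesis hOmega : (2 <= #|Omega|)%N.

(** Two distinct states carry a nonzero function of mean zero; otherwise the extrema defining the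
    gaps would run over the empty set. *)
Lemma L20_neq0 : exists h, (L20 mu `\ (0 : Omega -> R)) h.
Proof.
have [a [b [_ _ ab]]] := card_gt1P hOmega.
exists (mu b *: atom R a - mu a *: atom R b); split.
  rewrite /L20 /= -/(mean mu _) meanB !meanZ !mean_atom //.
  by rewrite mulrC subrr.
move=> /= /(congr1 (fun h => h a)); rewrite !fctE /GRing.scale /=.
rewrite /atom eqxx (negPf ab) mulr1 mulr0 subr0 => mub.
by have := mu_gt0 b; rewrite mub ltxx.
Qed.

Lemma poincare_gap_gt0 : 0 < poincare_gap p mu.
Proof.
have [c c0 hc] := poincare_inequality; apply: (lt_le_trans c0).
have [h hL] := L20_neq0; apply: lb_le_inf; first by exists (nm (h - P h) / nm h), h.
move=> _ [g [g0 /eqP gn0] <-]; rewrite ler_pdivlMr ?norm_gt0 //.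
exact: hc.
Qed.

Lemma absolute_gap_ge0 : 0 <= absolute_gap p mu.
Proof.
rewrite subr_ge0; have [h hL] := L20_neq0.
apply: ge_sup; first by exists (nm (P h) / nm h), h.
move=> _ [g [g0 /eqP gn0] <-].
by rewrite ler_pdivrMr ?norm_gt0 // mul1r norm_markov_le.
Qed.

Lemma absolute_gap_le1 : absolute_gap p mu <= 1.
Proof.
have [h [h0 /eqP hn0]] := L20_neq0.
rewrite -subr_ge0 -(pmulr_lge0 _ (norm_gt0 mu_ge0 mu_gt0 hn0)).
exact: le_trans (norm_ge0 _ _) (absolute_gap_le h0).
Qed.

(** From [eta_p^2 |g|^2 <= |g - Pg|^2 <= 2 <g, g - Pg>] the gap is at least [eta_p^2 / 2]. *)
Lemma spectral_gap_gt0 : 0 < spectral_gap p mu.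
Proof.
have e0 := poincare_gap_gt0; have [h hL] := L20_neq0.
have e20 : 0 < poincare_gap p mu ^+ 2 / 2 by rewrite divr_gt0 ?exprn_gt0.
apply: (lt_le_trans e20); rewrite lerBrDl -lerBrDr.
apply: ge_sup; first by exists (ip h (P h) / nm h ^+ 2), h.
move=> _ [g [g0 /eqP gn0] <-].
rewrite ler_pdivrMr ?exprn_gt0 ?norm_gt0 // norm_sqr //.
have := inner_subP_ge hp hmu g.
have : poincare_gap p mu ^+ 2 * ip g g <= ip (g - P g) (g - P g).
  rewrite -!norm_sqr // -exprMn ler_sqr ?nnegrE ?mulr_ge0 ?norm_ge0 ?(ltW e0) //.
  exact: poincare_gap_le.
have -> : ip g (P g) = ip g g - ip g (g - P g) by rewrite innerBr subKr.
lra.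
Qed.

End Gap.

(** * Expectations along trajectories *)

Section PathExpectation.
Variables (R : realType) (Omega : finType) (p : Omega -> Omega -> R).
Implicit Types (nu : Omega -> R) (F G : Omega -> seq Omega -> R).

(* Trajectories are given by the current state and the list of the past states,
   most recent first. *)
Fixpoint path_exp nu n F : R :=
  if n is n'.+1
  then path_exp nu n' (fun x s => \sum_y p x y * F y (x :: s))
  else \sum_x nu x * F x [::].

Fixpoint pair_count (a b y : Omega) (s : seq Omega) : nat :=
  if s is x :: s' then ((x, y) == (a, b)) + pair_count a b x s' else 0.

Lemma path_expD nu n F G : path_exp nu n (fun x s => F x s + G x s) =
  path_exp nu n F + path_exp nu n G.
Proof.
elim: n F G => [|n IH] F G /=.
  by rewrite -big_split; apply: eq_bigr => x _; rewrite mulrDr.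
rewrite -IH; congr path_exp; apply/funext => x; apply/funext => s.
by rewrite -big_split; apply: eq_bigr => y _; rewrite mulrDr.
Qed.

Lemma path_expZ nu n c F : path_exp nu n (fun x s => c * F x s) =
  c * path_exp nu n F.
Proof.
elim: n F => [|n IH] F /=.
  by rewrite mulr_sumr; apply: eq_bigr => x _; rewrite mulrCA.
rewrite -IH; congr path_exp; apply/funext => x; apply/funext => s.
by rewrite mulr_sumr; apply: eq_bigr => y _; rewrite mulrCA.
Qed.

Lemma path_exp_sum nu n (I : finType) (F : I -> Omega -> seq Omega -> R) :
  path_exp nu n (fun x s => \sum_i F i x s) = \sum_i path_exp nu n (F i).
Proof.
elim: n F => [|n IH] F /=.
  rewrite exchange_big; apply: eq_bigr => x _; exact: mulr_sumr.
rewrite -IH; congr path_exp; apply/funext => x; apply/funext => s.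
by rewrite exchange_big; apply: eq_bigr => y _; rewrite mulr_sumr.
Qed.

Hypothesis p_ge0 : forall u v, 0 <= p u v.

Lemma le_path_exp nu n F G : (forall x, 0 <= nu x) ->
  (forall x s, F x s <= G x s) -> path_exp nu n F <= path_exp nu n G.
Proof.
move=> nu0; elim: n F G => [|n IH] F G FG /=.
  by apply: ler_sum => x _; rewrite ler_wpM2l.
by apply: IH => x s; apply: ler_sum => y _; rewrite ler_wpM2l.
Qed.

(** The initial law enters only in the last sum, against a nonnegative function. This reduces second
    moments to the stationary chain at the price of a factor [c]. *)
Lemma path_exp_density_le nu mu c n F : (forall x, nu x <= c * mu x) ->
  (forall x s, 0 <= F x s) -> path_exp nu n F <= c * path_exp mu n F.
Proof.
move=> numu; elim: n F => [|n IH] F F0 /=.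
  by rewrite mulr_sumr; apply: ler_sum => x _; rewrite mulrA ler_wpM2r.
by apply: IH => x s; apply: sumr_ge0 => y _; rewrite mulr_ge0.
Qed.

(* [r] counts the steps that remain to be done. *)
Lemma path_exp_potential nu (V : nat -> Omega -> seq Omega -> R) n :
  (forall x, 0 <= nu x) ->
  (forall r x s, \sum_y p x y * V r y (x :: s) <= V r.+1 x s) ->
  path_exp nu n (V 0%N) <= \sum_x nu x * V n x [::].
Proof.
move=> nu0 VS.
(* Integrating out one step turns [V r] into [V r.+1], so the induction needs an arbitrary starting
   index. *)
suff H r : path_exp nu n (V r) <= \sum_x nu x * V (r + n)%N x [::] by exact: H.
elim: n r => [|n IH] r; first by rewrite addn0.
rewrite addnS -addSn; apply: le_trans (IH r.+1) => /=.
by apply: le_path_exp => // x s; exact: VS.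
Qed.

End PathExpectation.

(** * Second moment of the centred count for the stationary chain *)

Section SecondMoment.
Variables (R : realType) (Omega : finType).
Variables (p : Omega -> Omega -> R) (mu : Omega -> R).
Hypotheses (hp : transition_matrix p) (hmu : invariant_distribution p mu).
Hypothesis hirr : irreducible_transition p.
Implicit Types (f g h : Omega -> R).
Local Notation ip := (inner_mu mu).
Local Notation nm := (norm_mu mu).
Local Notation P := (markov_act p).

Let mu_gt0 u : 0 < mu u. Proof. exact: (invariant_gt0 hp hmu hirr). Qed.
Let mu_ge0 u : 0 <= mu u. Proof. exact: ltW. Qed.
Let mu_sum1 : \sum_u mu u = 1. Proof. by case: hmu => -[]. Qed.
Let p_sum1 u : \sum_v p u v = 1. Proof. by case: (hp u). Qed.

Lemma path_exp_last n h : path_exp p mu n (fun x _ => h x) = mean mu h.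
Proof. by elim: n h => //= n IH h; rewrite IH mean_markov. Qed.

(** Crossings at times [i < k] are separated by [l = k - i - 1] further steps; [P^l] is summed over
    all such pairs of times below [n]. *)
Definition double_sum n h : Omega -> R :=
  fun x => \sum_(k < n) \sum_(l < k) iter l P h x.

Section OnePair.
Variables a b : Omega.
Let m := mu a * p a b.
Let F x y : R := ((x, y) == (a, b))%:R - m.

Definition centered_count (y : Omega) (s : seq Omega) : R :=
  (pair_count a b y s)%:R - (size s)%:R * m.

Let countS y x s : centered_count y (x :: s) = centered_count x s + F x y.
Proof. rewrite /centered_count /F /= natrD -natr1; ring. Qed.

Let FE h x : \sum_y p x y * (F x y * h y) =
  p a b * h b * atom R a x - m * P h x.
Proof.
rewrite /F /markov_act mulr_sumr.
under eq_bigr do rewrite mulrBl mulrBr.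
rewrite sumrB; congr (_ - _); last by apply: eq_bigr => y _; ring.
rewrite (bigD1 b) //= big1 ?addr0 => [|y yb].
  by rewrite xpair_eqE eqxx andbT /atom; case: eqP => [->|_] /=; ring.
by rewrite xpair_eqE (negPf yb) andbF mul0r mulr0.
Qed.

(** Conditioning on the last step, the old count is tested against [P h], while the new increment
    contributes [m * h b], its part [- m * P h] having mean zero. *)
Lemma centered_count_corr n h : mean mu h = 0 ->
  path_exp p mu n (fun x s => centered_count x s * h x) =
  m * \sum_(l < n) iter l P h b.
Proof.
elim: n h => [|n IH] h h0.
  rewrite big_ord0 mulr0 /= big1 // => x _.
  by rewrite /centered_count /= mul0r subrr mul0r mulr0.
rewrite /=.
under eq_fun => x.
  under eq_fun => s.
    under eq_bigr do rewrite countS mulrDl mulrDr mulrCA.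
    rewrite big_split /= -mulr_sumr FE -[\sum_i p x i * h i]/(P h x).
    over.
  over.
rewrite path_expD (path_exp_last n (fun x => _ - _)) IH ?mean_markov //.
have -> : (fun x => p a b * h b * atom R a x - m * P h x) =
  (p a b * h b) *: atom R a - m *: P h by [].
rewrite meanB !meanZ mean_markov // h0 mulr0 subr0 mean_atom //.
rewrite big_ord_recl mulrDr addrC; congr (_ + _).
  by rewrite /m /=; ring.
by congr (_ * _); apply: eq_bigr => l _; rewrite /= -iterSr.
Qed.

Let F_mean x : \sum_y p x y * F x y = p a b * atom R a x - m.
Proof.
have := FE (fun=> 1) x; rewrite -/(cst 1) markov_cst // !mulr1 => <-.
by apply: eq_bigr => y _; rewrite /= mulr1.
Qed.

Let F_sqr x : \sum_y p x y * F x y ^+ 2 =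
  (p a b - 2 * m * p a b) * atom R a x + m ^+ 2.
Proof.
under eq_bigr do rewrite expr2.
rewrite FE -[P _ x]/(\sum_y p x y * F x y) F_mean /F xpair_eqE eqxx andbT /atom.
by case: eqP => _ /=; ring.
Qed.

(** Expanding the square at the last step, the increment has conditional mean [p a b] times the
    centred atom at [a]; its correlation with the old count adds one more inner sum of
    [double_sum]. *)
Lemma centered_count_second_moment n :
  path_exp p mu n (fun x s => centered_count x s ^+ 2) =
  n%:R * (m - m ^+ 2) + 2 * m * p a b *
    double_sum n (centered mu (atom R a)) b.
Proof.
elim: n => [|n IH].
  rewrite /double_sum big_ord0 mulr0 mul0r addr0 /= big1 // => x _.
  by rewrite /centered_count /= mul0r subrr expr0n mulr0.
rewrite /=.
under eq_fun => x.
  under eq_fun => s.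
    have -> : \sum_y p x y * centered_count y (x :: s) ^+ 2 =
      centered_count x s ^+ 2 +
        ((2 * p a b) * (centered_count x s * centered mu (atom R a) x) +
         ((p a b - 2 * m * p a b) * atom R a x + m ^+ 2)).
      transitivity (\sum_y (p x y * centered_count x s ^+ 2
          + 2 * centered_count x s * (p x y * F x y) + p x y * F x y ^+ 2)).
        by apply: eq_bigr => y _; rewrite countS; ring.
      rewrite !big_split /= -mulr_suml p_sum1 mul1r -mulr_sumr F_mean F_sqr.
      by rewrite /centered !fctE mean_atom /m; ring.
    over.
  over.
rewrite 2!path_expD IH path_expZ centered_count_corr ?mean_centered //.
rewrite (path_exp_last n (fun x => _ + _)).
have -> : (fun x => (p a b - 2 * m * p a b) * atom R a x + m ^+ 2) =
  (p a b - 2 * m * p a b) *: atom R a + cst (m ^+ 2) by [].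
rewrite meanD meanZ mean_atom // mean_cst // /double_sum big_ord_recr /= -natr1 /m.
ring.
Qed.

End OnePair.
End SecondMoment.

(** * Mean square error *)

Section DoubleSum.
Variables (R : realType) (Omega : finType).
Variables (p : Omega -> Omega -> R) (mu : Omega -> R).
Hypotheses (hp : transition_matrix p) (hmu : invariant_distribution p mu).
Hypothesis hirr : irreducible_transition p.
Hypothesis hOmega : (2 <= #|Omega|)%N.
Implicit Types (f g h : Omega -> R).
Local Notation ip := (inner_mu mu).
Local Notation nm := (norm_mu mu).
Local Notation P := (markov_act p).

Let mu_gt0 u : 0 < mu u. Proof. exact: (invariant_gt0 hp hmu hirr). Qed.
Let mu_ge0 u : 0 <= mu u. Proof. exact: ltW. Qed.
Let mu_sum1 : \sum_u mu u = 1. Proof. by case: hmu => -[]. Qed.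
Let p_ge0 u v : 0 <= p u v. Proof. by case: (hp u). Qed.
Let p_sum1 u : \sum_v p u v = 1. Proof. by case: (hp u). Qed.

Lemma inner_double_sum n f h : ip f (double_sum p n h) =
  \sum_(k < n) \sum_(l < k) ip f (iter l P h).
Proof.
rewrite /inner_mu; under [RHS]eq_bigr do rewrite exchange_big /=.
rewrite [RHS]exchange_big /=; apply: eq_bigr => x _.
by rewrite mulr_sumr; apply: eq_bigr => k _; rewrite mulr_sumr.
Qed.

Lemma iter_markovB l f g : iter l P (f - g) = iter l P f - iter l P g.
Proof. by elim: l => //= l ->; rewrite markov_actB. Qed.

Lemma inner_iter_sum k f g :
  \sum_(l < k) ip f (iter l P (g - P g)) = ip f g - ip f (iter k P g).
Proof.
rewrite -(big_mkord xpredT (fun l => ip f (iter l P (g - P g)))).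
under eq_bigr do rewrite iter_markovB -iterSr innerBr.
by rewrite (telescope_sumr_eq (fun l => - ip f (iter l P g))) // => [|l _];
  rewrite ?opprK addrC.
Qed.

(** The operator norm of the double sum on mean-zero functions is at most [K], in bilinear form. *)
Definition double_sum_bound n (K : R) := forall f h,
  mean mu f = 0 -> mean mu h = 0 -> ip f (double_sum p n h) <= K * (nm f * nm h).

(** For [h = g - P g] the inner sum telescopes to [<f, g> - <f, P^k g>], at most [2 |f| |g|]. *)
Lemma double_sum_poincare n :
  double_sum_bound n (n%:R * (2 / poincare_gap p mu)).
Proof.
move=> f h f0 h0; have e0 := poincare_gap_gt0 hp hmu hirr hOmega.
have [g g0 gE] := poisson_solution hp hmu hirr h0.
have gh : nm g <= nm h / poincare_gap p mu.
  by rewrite ler_pdivlMr // mulrC -gE poincare_gap_le.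
rewrite inner_double_sum -gE.
under eq_bigr do rewrite inner_iter_sum.
rewrite gE -mulrA (mulr_natl _ n) -[X in _ *+ X]card_ord -sumr_const.
apply: ler_sum => k _.
apply: le_trans (_ : nm f * (nm g + nm g) <= _).
  rewrite mulrDr lerD ?inner_le_norm // -innerNr.
  apply: le_trans (inner_le_norm mu_ge0 _ _) _.
  by rewrite normN ler_wpM2l ?norm_ge0 // norm_iter_markov_le.
have := ler_wpM2l (norm_ge0 mu f) gh; lra.
Qed.

Lemma double_sum_absolute n : 0 < absolute_gap p mu ->
  double_sum_bound n (n%:R * (1 / absolute_gap p mu)).
Proof.
set e := absolute_gap p mu => e0 f h f0 h0.
have e1 : 0 <= 1 - e.
  by rewrite subr_ge0; exact: absolute_gap_le1 hp hmu hirr hOmega.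
have Ph l : nm (iter l P h) <= (1 - e) ^+ l * nm h.
  elim: l => [|l IH]; first by rewrite expr0 mul1r.
  apply: le_trans (absolute_gap_le hp hmu hirr _) _; first by rewrite mean_iter_markov.
  by rewrite exprS -mulrA ler_wpM2l.
rewrite inner_double_sum -mulrA (mulr_natl _ n) -[X in _ *+ X]card_ord -sumr_const.
apply: ler_sum => k _.
apply: le_trans (_ : \sum_(l < k) (1 - e) ^+ l * (nm f * nm h) <= _).
  apply: ler_sum => l _; apply: le_trans (inner_le_norm mu_ge0 _ _) _.
  by rewrite mulrCA ler_wpM2l ?norm_ge0.
rewrite -mulr_suml ler_wpM2r ?mulr_ge0 ?norm_ge0 // ler_pdivlMr //.
(* The geometric sum satisfies [e * s = 1 - (1 - e)^k <= 1]. *)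
have := subrX1 (1 - e) k; have := exprn_ge0 k e1.
set s := \sum_(i < k) _; nra.
Qed.

Lemma reversible_selfadjoint f g : reversible_chain p mu -> ip (P f) g = ip f (P g).
Proof.
move=> rev; rewrite /inner_mu /markov_act.
under eq_bigr do rewrite mulr_sumr mulr_suml.
rewrite exchange_big /=; apply: eq_bigr => u _.
by rewrite mulr_sumr; apply: eq_bigr => v _; rewrite mulrA rev; ring.
Qed.

Lemma reversible_selfadjoint_iter l f g : reversible_chain p mu ->
  ip (iter l P f) g = ip f (iter l P g).
Proof.
by move=> rev; elim: l f g => //= l IH f g; rewrite reversible_selfadjoint // IH -iterSr.
Qed.

(* Consecutive terms group into [<P^i h, (I + P) P^i h> >= 0]. *)
Lemma reversible_iter_sum_ge0 k h : reversible_chain p mu ->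
  0 <= \sum_(l < k) ip h (iter l P h).
Proof.
move=> rev.
have evenE i : ip h (iter i.*2 P h) = ip (iter i P h) (iter i P h).
  by rewrite reversible_selfadjoint_iter // -iterD addnn.
have oddE i : ip h (iter i.*2.+1 P h) = ip (iter i P h) (P (iter i P h)).
  by rewrite reversible_selfadjoint_iter // -iterS -iterD addnS addnn.
have pair g : 0 <= ip g g + ip g (P g).
  have := inner_le_norm mu_ge0 (- g) (P g).
  rewrite innerNl normN -norm_sqr // => gP.
  have := norm_markov_le hp hmu g; have := norm_ge0 mu g; nra.
have dbl i : 0 <= \sum_(l < i.*2) ip h (iter l P h).
  elim: i => [|i IH]; first by rewrite big_ord0.
  by rewrite doubleS !big_ord_recr /= -addrA addr_ge0 // evenE oddE.
rewrite -[k]odd_double_half; case: (odd k) => /=; last by rewrite add0n dbl.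
by rewrite add1n big_ord_recr /= addr_ge0 ?dbl // evenE inner_ge0.
Qed.

(** The double sum defines a symmetric semidefinite form [B]; by Cauchy-Schwarz for [B] it suffices
    to bound the diagonal. *)
Lemma double_sum_reversible n : reversible_chain p mu ->
  double_sum_bound n (n%:R * (1 / spectral_gap p mu)).
Proof.
move=> rev; set e := spectral_gap p mu.
have e0 : 0 < e by exact: spectral_gap_gt0.
pose B f h := ip f (double_sum p n h).
have Bge0 h : 0 <= B h h.
  by rewrite /B inner_double_sum sumr_ge0 // => k _; exact: reversible_iter_sum_ge0.
have Ble h : mean mu h = 0 -> B h h <= n%:R * (1 / e) * ip h h.
  move=> h0; have [g g0 gE] := poisson_solution hp hmu hirr h0.
  (* From [e |g|^2 <= <g, h> <= |g| |h|] one gets [e |g| <= |h|]. *)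
  have gh : ip h g <= ip h h / e.
    have /= := spectral_gap_le hp hmu hirr g0; rewrite -/e gE innerC => eg.
    have := inner_le_norm mu_ge0 h g; rewrite -norm_sqr // in eg *.
    have nh := norm_ge0 mu h; have ng := norm_ge0 mu g => hg.
    have nge : e * nm g <= nm h by nra.
    rewrite ler_pdivlMr // -norm_sqr //; nra.
  rewrite /B inner_double_sum -gE; under eq_bigr do rewrite inner_iter_sum.
  rewrite sumrB gE sumr_const card_ord.
  (* Symmetry moves [P^k] onto [h = g - P g], and the sum telescopes to [|g|^2 - <g, P^n g>]. *)
  have : 0 <= \sum_(k < n) ip h (iter k P g).
    have -> : \sum_(k < n) ip h (iter k P g) = \sum_(k < n) ip g (iter k P h).
      apply: eq_bigr => k _.
      by rewrite -reversible_selfadjoint_iter // innerC.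
    rewrite -gE inner_iter_sum subr_ge0.
    apply: le_trans (inner_le_norm mu_ge0 _ _) _.
    by rewrite -norm_sqr // expr2 ler_wpM2l ?norm_ge0 // norm_iter_markov_le.
  rewrite -mulr_natl; have := ler_wpM2l (ler0n R n) gh.
  rewrite -mulrA; lra.
have Bsym f h : B f h = B h f.
  rewrite /B !inner_double_sum; apply: eq_bigr => k _; apply: eq_bigr => l _.
  by rewrite -reversible_selfadjoint_iter // innerC.
have Blin f g s : B (f + s *: g) (f + s *: g) = B f f + 2 * s * B f g + s ^+ 2 * B g g.
  have Bl f1 g1 : B (f1 + s *: g) g1 = B f1 g1 + s * B g g1.
    by rewrite /B innerDl innerZl.
  rewrite Bl (Bsym f) Bl (Bsym g (_ + _)) Bl (Bsym g f); ring.
move=> f h f0 h0.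
have BCS : B f h ^+ 2 <= B f f * B h h.
  by apply: quadratic_ge0_disc => // s; rewrite -Blin.
have K0 : 0 <= n%:R * (1 / e) by rewrite mulr_ge0 // divr_ge0 // ltW.
have : B f h ^+ 2 <= (n%:R * (1 / e) * (nm f * nm h)) ^+ 2.
  apply: le_trans BCS _; rewrite !exprMn !norm_sqr //.
  apply: le_trans (ler_pM (Bge0 _) (Bge0 _) (Ble _ f0) (Ble _ h0)) _.
  by rewrite le_eqVlt; apply/orP; left; apply/eqP; ring.
rewrite -/(B f h); case: (lerP (B f h) 0) => [Bf0 _|Bf0].
  by apply: le_trans Bf0 _; rewrite mulr_ge0 ?K0 ?mulr_ge0 ?norm_ge0.
by rewrite ler_sqr ?nnegrE ?(ltW Bf0) ?(mulr_ge0 K0) ?mulr_ge0 ?norm_ge0.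
Qed.

(** The square is [p a b] times [mu a * p a b] times [mu b], with factors at most 1, [mu b] and
    [mu b]. It absorbs the norms of the two atoms. *)
Lemma transition_sqrt_le a b : p a b * (Num.sqrt (mu a) * Num.sqrt (mu b)) <= mu b.
Proof.
rewrite -ler_sqr ?nnegrE ?mulr_ge0 ?sqrtr_ge0 // !exprMn !sqr_sqrtr //.
have pab : mu a * p a b <= mu b.
  rewrite -[leRHS]hmu.2 (bigD1 a) //= lerDl; apply: sumr_ge0 => v _; exact: mulr_ge0.
have := transition_le1 hp a b => p1.
have -> : p a b ^+ 2 * (mu a * mu b) = p a b * (mu a * p a b * mu b) by ring.
apply: le_trans (_ : 1 * (mu b * mu b) <= _); last by rewrite mul1r expr2.
by rewrite ler_pM // ?mulr_ge0 // ler_wpM2r.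
Qed.

(** Each pair contributes at most [m * (n + 2 K)], and the masses [m] sum to 1. *)
Lemma centered_count_sum n K : 0 <= K -> double_sum_bound n K ->
  \sum_a \sum_b path_exp p mu n
    (fun x s => centered_count p mu a b x s ^+ 2) <= n%:R + 2 * K.
Proof.
move=> K0 HK.
have sum_m : \sum_a \sum_b mu a * p a b = 1.
  by under eq_bigr do rewrite -mulr_sumr p_sum1 mulr1.
rewrite -[leRHS]mulr1 -[X in _ <= _ * X]sum_m mulr_sumr; apply: ler_sum => a _.
rewrite mulr_sumr; apply: ler_sum => b _.
rewrite centered_count_second_moment //; set m := mu a * p a b.
have m0 : 0 <= m by rewrite mulr_ge0.
set phi := centered mu (atom R a).
have phi0 : mean mu phi = 0 by rewrite mean_centered.
(* Evaluation at [b] may thus use the centred atom at [b], to which [HK] applies. *)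
have T0 : mean mu (double_sum p n phi) = 0.
  have -> : mean mu (double_sum p n phi) = ip (cst 1) (double_sum p n phi).
    by apply: eq_bigr => x _; rewrite fctE mulr1.
  rewrite inner_double_sum big1 // => k _; rewrite big1 // => l _.
  transitivity (mean mu (iter l P phi)); last by rewrite mean_iter_markov.
  by apply: eq_bigr => x _; rewrite fctE mulr1.
have key : p a b * double_sum p n phi b <= K.
  rewrite -(ler_pM2l (mu_gt0 b)) mulrCA -inner_atom -inner_centered //.
  apply: le_trans (_ : p a b * (K * (nm (centered mu (atom R b)) * nm phi)) <= _).
    by rewrite ler_wpM2l // HK // mean_centered.
  apply: le_trans (_ : p a b * (K * (Num.sqrt (mu b) * Num.sqrt (mu a))) <= _).
    rewrite ler_wpM2l // ler_wpM2l // ler_pM ?norm_ge0 // -norm_atom //;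
      exact: norm_centered.
  rewrite mulrCA (mulrC (mu b)) ler_wpM2l // (mulrC (Num.sqrt (mu b))).
  exact: transition_sqrt_le.
have -> : 2 * m * p a b * double_sum p n phi b = 2 * m * (p a b * double_sum p n phi b).
  by rewrite !mulrA.
have : 2 * m * (p a b * double_sum p n phi b) <= 2 * m * K.
  by rewrite ler_wpM2l // mulr_ge0.
have : 0 <= n%:R * m ^+ 2 by rewrite mulr_ge0 // sqr_ge0.
lra.
Qed.

End DoubleSum.

(** * Resolvents *)

(** Continuity method. At the supremum [s] of the parameters with [u >= 0], the Lipschitz bound
    gives [u s >= 0] and the last hypothesis strict positivity; as [X] is finite there is a margin,
    which carries nonnegativity past [s] unless [s = d1]. *)
Lemma positive_continuation (R : realType) (X : finType) (u : R -> X -> R)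
    (d0 d1 L : R) : d0 <= d1 -> 0 <= L ->
  (forall d d' x, d0 <= d <= d1 -> d0 <= d' <= d1 ->
     `|u d x - u d' x| <= L * `|d - d'|) ->
  (forall x, 0 < u d0 x) ->
  (forall d, d0 <= d <= d1 -> (forall x, 0 <= u d x) -> forall x, 0 < u d x) ->
  forall x, 0 < u d1 x.
Proof.
move=> d01 L0 lip u0 prop.
have L1 : 0 < L + 1 by rewrite ltr_wpDl.
pose S := [set d | d0 <= d <= d1 /\ forall x, 0 <= u d x].
have S0 : S d0 by split=> [|x]; [rewrite lexx | exact: ltW].
have Sub : has_ubound S by exists d1 => d [/andP[]].
have Ssup : has_sup S by split; [exists d0 |].
pose s := sup S.
have sI : d0 <= s <= d1.
  apply/andP; split; first exact: ub_le_sup.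
  by apply: ge_sup => [|d [/andP[]]//]; exists d0.
have us0 x : 0 <= u s x.
  rewrite leNgt; apply/negP => us.
  have e0 : 0 < - u s x / (L + 1) by rewrite divr_gt0 // oppr_gt0.
  have [d [dI du] sd] := sup_adherent e0 Ssup.
  have ds : d <= s by exact: ub_le_sup.
  have := lip d s x dI sI; have -> : `|d - s| = s - d.
    by rewrite distrC ger0_norm ?subr_ge0.
  have := ler_norm (u d x - u s x); have := du x.
  have : s - d < - u s x / (L + 1) by rewrite -/s in sd; lra.
  rewrite ltr_pdivlMr //; nra.
have us := prop s sI us0.
suff -> : d1 = s by [].
apply/eqP; rewrite eq_le (andP sI).2 andbT leNgt; apply/negP => sd1.
have [c c0 cu] : exists2 c, 0 < c & forall x, c <= u s x.
  case: (pickP (fun _ : X => true)) => [x0 _|X0]; last by exists 1 => // x; have := X0 x.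
  exists (u s [arg min_(i < x0) u s i]%O) => // x.
  by case: arg_minP => //= i _; apply.
pose d := Num.min d1 (s + c / (L + 1)).
have sd : s < d by rewrite lt_min sd1 ltrDl divr_gt0.
have dI : d0 <= d <= d1.
  by rewrite ge_min lexx andbT (le_trans (andP sI).1) // ltW.
suff /(ub_le_sup Sub) : S d by rewrite leNgt sd.
split=> // x; have := lip s d x sI dI; have -> : `|s - d| = d - s.
  by rewrite distrC gtr0_norm ?subr_gt0.
have : d - s <= c / (L + 1) by rewrite lerBlDl ge_min lexx orbT.
rewrite ler_pdivlMr //.
have := ler_norm (u s x - u d x); have := cu x; nra.
Qed.

Section Resolvent.
Variables (R : realType) (Omega : finType).
Variables (p : Omega -> Omega -> R) (mu : Omega -> R).
Hypotheses (hp : transition_matrix p) (hmu : invariant_distribution p mu).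
Hypothesis hirr : irreducible_transition p.
Hypothesis hOmega : (2 <= #|Omega|)%N.
Implicit Types (f g h : Omega -> R).
Local Notation ip := (inner_mu mu).
Local Notation nm := (norm_mu mu).
Local Notation P := (markov_act p).
Local Notation eta := (poincare_gap p mu).

Let mu_gt0 u : 0 < mu u. Proof. exact: (invariant_gt0 hp hmu hirr). Qed.
Let mu_ge0 u : 0 <= mu u. Proof. exact: ltW. Qed.
Let mu_sum1 : \sum_u mu u = 1. Proof. by case: hmu => -[]. Qed.
Let p_ge0 u v : 0 <= p u v. Proof. by case: (hp u). Qed.

(** The operator [z - P] for [z = 1 + c]; [c] is positive for the upper tail and negative for the
    lower one. *)
Definition shifted (c : R) h := (1 + c) *: h - P h.

Definition coercive_shift (c kappa : R) :=
  forall g, mean mu g = 0 -> kappa * nm g <= nm (shifted c g).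

Lemma shiftE c h : shifted c h = (h - P h) + c *: h.
Proof. by rewrite /shifted scalerDl scale1r addrAC. Qed.

Lemma mean_shift c h : mean mu (shifted c h) = c * mean mu h.
Proof. by rewrite shiftE meanD meanB meanZ mean_markov // subrr add0r. Qed.

Lemma shift_centered c h : shifted c (centered mu h) = centered mu (shifted c h).
Proof.
rewrite /centered mean_shift !shiftE markov_actB markov_cst //.
by apply/funext => x; rewrite !fctE /GRing.scale /=; ring.
Qed.

(** Since [I - P] is accretive, adding [c *: g] to [g - P g] creates no negative cross term, and the
    full gap survives. *)
Lemma coercive_shift_pos c : 0 <= c -> coercive_shift c eta.
Proof.
move=> c0 g g0; apply: le_trans (poincare_gap_le hp hmu hirr g0) _.
have key d : 0 <= ip g d -> ip d d <= ip (d + c *: g) (d + c *: g).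
  move=> /(mulr_ge0 c0).
  rewrite innerDl !innerDr !innerZl !innerZr (innerC mu d g).
  have := mulr_ge0 c0 (mulr_ge0 c0 (inner_ge0 mu_ge0 g)); lra.
by apply: norm_le => //; rewrite shiftE key // inner_subP_ge0.
Qed.

Lemma coercive_shift_neg d : 0 <= d -> coercive_shift (- d) (eta - d).
Proof.
move=> d0 g g0.
have := normD mu_ge0 (shifted (- d) g) (d *: g).
rewrite shiftE scaleNr subrK normZ ger0_norm //.
have := poincare_gap_le hp hmu hirr g0; lra.
Qed.

Section Solve.
Variables (c kappa : R).
Hypotheses (c0 : c != 0) (k0 : 0 < kappa) (ck : coercive_shift c kappa).

Lemma norm_shift_centered h : nm (centered mu h) <= nm (shifted c h) / kappa.
Proof.
rewrite ler_pdivlMr // mulrC; apply: le_trans (ck _) _; first by rewrite mean_centered.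
by rewrite shift_centered norm_centered.
Qed.

(** The shift multiplies the mean by [c] and is coercive on the centred part; the two inverse bounds
    add up. *)
Lemma norm_shift h : nm h <= (`|c|^-1 + kappa^-1) * nm (shifted c h).
Proof.
have hE : h = cst (mean mu h) + centered mu h by rewrite /centered addrC subrK.
rewrite {1}hE; apply: le_trans (normD mu_ge0 _ _) _.
rewrite mulrDl; apply: lerD; last by rewrite mulrC norm_shift_centered.
have nm_cst k : nm (cst k) = `|k|.
  rewrite -sqrtr_sqr /norm_mu; congr Num.sqrt; rewrite -[RHS](mean_cst mu_sum1).
  by apply: eq_bigr => x _; rewrite !fctE; ring.
have mean_le f : `|mean mu f| <= nm f.
  have H g : mean mu g <= nm g.
    have -> : mean mu g = ip (cst 1) g by apply: eq_bigr => x _; rewrite fctE mulr1.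
    by apply: le_trans (inner_le_norm mu_ge0 _ _) _; rewrite nm_cst normr1 mul1r.
  by rewrite ler_norml H andbT lerNl -meanN -(normN mu f) H.
rewrite nm_cst ler_pdivlMl ?normr_gt0 // -normrM -mean_shift; exact: mean_le.
Qed.

Lemma shift_inj h : shifted c h = 0 -> h = 0.
Proof.
move=> h0; apply/eqP; rewrite -[_ == _]negbK; apply/negP => hn0.
have := norm_shift h; rewrite h0 norm0 mulr0.
by rewrite leNgt norm_gt0.
Qed.

Lemma shift_solution g : exists f, shifted c f = g.
Proof.
pose K u v := (1 + c) * (u == v)%:R - p u v.
have KE h : markov_act K h = shifted c h.
  apply/funext => u; rewrite /shifted /markov_act !fctE.
  under eq_bigr do rewrite mulrBl -mulrA.
  rewrite sumrB -mulr_sumr; congr (_ * _ - _).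
  rewrite -[RHS](sum_atom h); apply: eq_bigr => v _.
  by rewrite mulrC /atom eq_sym.
have [h|J [_ JK]] := @inverse_kernel R Omega K; first by rewrite KE; exact: shift_inj.
by exists (markov_act J g); rewrite -KE.
Qed.

Variables (a b : Omega) (f : Omega -> R).
Hypothesis fE : shifted c f = atom R a.

Lemma mean_resolvent : mean mu f = mu a / c.
Proof.
by rewrite -(mean_atom mu a) -fE mean_shift mulrC mulKf.
Qed.

Lemma resolvent_at : `|f b - mu a / c| <= Num.sqrt (mu a) / kappa / Num.sqrt (mu b).
Proof.
have -> : f b - mu a / c = centered mu f b by rewrite /centered fctE mean_resolvent.
have sb : 0 < Num.sqrt (mu b) by rewrite sqrtr_gt0.
rewrite ler_pdivlMr // -(ler_pM2r sb) -mulrA -expr2 sqr_sqrtr // mulrC.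
rewrite -{1}[mu b]ger0_norm // -normrM -inner_atom.
have fa : nm (centered mu f) <= Num.sqrt (mu a) / kappa.
  by rewrite -norm_atom // -fE norm_shift_centered.
have H g : nm g <= Num.sqrt (mu a) / kappa ->
    ip (atom R b) g <= Num.sqrt (mu a) / kappa * Num.sqrt (mu b).
  move=> ga; apply: le_trans (inner_le_norm mu_ge0 _ _) _.
  by rewrite norm_atom mulrC ler_wpM2r ?sqrtr_ge0.
by rewrite ler_norml lerNl -innerNr !H // normN.
Qed.

(** The value at [b] deviates by at most [sqrt (mu a / mu b) / kappa]; the factor [p a b] cancels
    the ratio, which leaves a bound uniform in the pair. *)
Lemma resolvent_pair : `|p a b * f b - mu a * p a b / c| <= kappa^-1.
Proof.
have -> : p a b * f b - mu a * p a b / c = p a b * (f b - mu a / c) by ring.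
rewrite normrM ger0_norm //.
apply: le_trans (ler_wpM2l (p_ge0 a b) resolvent_at) _.
have sb : 0 < Num.sqrt (mu b) by rewrite sqrtr_gt0.
rewrite mulrA ler_pdivrMr // mulrA mulrC ler_wpM2l ?invr_ge0 ?(ltW k0) //.
rewrite -(ler_pM2r sb) -expr2 sqr_sqrtr // -mulrA.
exact: (transition_sqrt_le hp hmu hirr).
Qed.

End Solve.

End Resolvent.

(** * Tails of the number of crossings *)

Lemma bernoulli_inequality (R : realDomainType) (x : R) n : 0 <= x ->
  1 + n%:R * x <= (1 + x) ^+ n.
Proof.
move=> x0; elim: n => [|n IH]; first by rewrite mul0r addr0 expr0.
rewrite exprS -natr1.
have := ler_wpM2l (addr_ge0 ler01 x0) IH.
have := mulr_ge0 (ler0n R n) (mulr_ge0 x0 x0); lra.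
Qed.

(* The condition on [k] says that [y |-> (y / (1 + y)) ^ k / y] increases up to [K]. *)
Lemma geometric_weight_mono (R : realFieldType) (y K : R) k : 0 < y -> y <= K ->
  K + 1 <= k%:R -> (y / (1 + y)) ^+ k / y <= (K / (1 + K)) ^+ k / K.
Proof.
move=> y0 yK; have K0 := lt_le_trans y0 yK.
case: k => [|j]; first by lra.
rewrite -natr1 lerD2r => Kj.
have y1 : 0 < 1 + y by rewrite addr_gt0.
have K1 : 0 < 1 + K by rewrite addr_gt0.
have E (z : R) : 0 < z -> (z / (1 + z)) ^+ j.+1 / z = (z / (1 + z)) ^+ j / (1 + z).
  by move=> z0; rewrite exprSr; field; rewrite !gt_eqF // addr_gt0.
rewrite !E //.
(* Chosen so that [K / (1 + K)] is [1 + e] times [y / (1 + y)]; Bernoulli's inequality for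
   [(1 + e)^j] then suffices, because [K <= j]. *)
pose e := (K - y) / ((1 + K) * y).
have e0 : 0 <= e by rewrite divr_ge0 ?subr_ge0 ?mulr_ge0 ?(ltW y0) ?(ltW K1).
have -> : K / (1 + K) = (1 + e) * (y / (1 + y)).
  by rewrite /e; field; rewrite !gt_eqF.
rewrite (exprMn _ (1 + e)) [leRHS]mulrAC [leRHS]mulrC ler_wpM2l //.
  by rewrite exprn_ge0 // divr_ge0 // ltW.
rewrite ler_pdivlMr // [leLHS]mulrC ler_pdivrMr //.
have B := bernoulli_inequality j e0.
apply: le_trans (ler_wpM2r (ltW y1) B).
have : K * e <= j%:R * e by rewrite ler_wpM2r.
have : K * e * (1 + y) = (K - y) * ((K * (1 + y)) / ((1 + K) * y)).
  by rewrite /e; field; rewrite !gt_eqF.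
have : 1 <= (K * (1 + y)) / ((1 + K) * y) by rewrite ler_pdivlMr ?mulr_gt0 //; lra.
nra.
Qed.

Section Tails.
Variables (R : realType) (Omega : finType).
Variables (p : Omega -> Omega -> R) (mu nu : Omega -> R).
Hypotheses (hp : transition_matrix p) (hmu : invariant_distribution p mu).
Hypothesis hirr : irreducible_transition p.
Hypothesis hOmega : (2 <= #|Omega|)%N.
Hypothesis nu_ge0 : forall x, 0 <= nu x.
Variable r : R.
Hypothesis nu_le : forall x, nu x <= r * mu x.
Implicit Types (f g h : Omega -> R).
Local Notation ip := (inner_mu mu).
Local Notation nm := (norm_mu mu).
Local Notation P := (markov_act p).
Local Notation eta := (poincare_gap p mu).

Let mu_gt0 u : 0 < mu u. Proof. exact: (invariant_gt0 hp hmu hirr). Qed.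
Let mu_ge0 u : 0 <= mu u. Proof. exact: ltW. Qed.
Let mu_sum1 : \sum_u mu u = 1. Proof. by case: hmu => -[]. Qed.
Let p_ge0 u v : 0 <= p u v. Proof. by case: (hp u). Qed.
Let p_sum1 u : \sum_v p u v = 1. Proof. by case: (hp u). Qed.
Let eta_gt0 : 0 < eta. Proof. exact: (poincare_gap_gt0 hp hmu hirr hOmega). Qed.

Lemma density_bound_ge0 : 0 <= r.
Proof.
have [a [_ [_ _ _]]] := card_gt1P hOmega.
by rewrite -(pmulr_lge0 _ (mu_gt0 a)) (le_trans (nu_ge0 a)).
Qed.

Lemma sum_le_mean f : (forall x, 0 <= f x) -> \sum_x nu x * f x <= r * mean mu f.
Proof.
by move=> f0; rewrite mulr_sumr; apply: ler_sum => x _; rewrite mulrA ler_wpM2r.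
Qed.

Variables a b : Omega.
Local Notation m := (mu a * p a b).
Hypothesis pab : 0 < p a b.

Let m_gt0 : 0 < m. Proof. exact: mulr_gt0. Qed.

Let sum_ind x : \sum_y (((x, y) == (a, b))%:R : R) = atom R a x.
Proof.
rewrite (bigD1 b) //= big1 ?addr0 => [|y yb].
  by rewrite xpair_eqE eqxx andbT.
by rewrite xpair_eqE (negPf yb) andbF.
Qed.

(** From [x], the mean of [z^-s] for the next crossing is [w * f x / f b], and every further
    crossing costs a factor [w]. The potential built from this dominates the indicator at the end,
    and its initial value involves only the mean of [f]. *)
Lemma upper_tail (d K : R) n k : 0 < d -> K = eta^-1 + m / d ->
  K + 1 <= k%:R ->
  path_exp p nu n (fun x s => ((k <= pair_count a b x s)%N)%:R)
    <= r * ((1 + d) ^+ n * (K / (1 + K)) ^+ k).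
Proof.
move=> d0 KE Kk; pose z := 1 + d.
have z0 : 0 < z by rewrite addr_gt0.
have ck := coercive_shift_pos hp hmu hirr (ltW d0).
have dn0 : d != 0 by rewrite gt_eqF.
have [f fE] := shift_solution hp hmu hirr dn0 eta_gt0 ck (atom R a).
have PfE x : P f x + atom R a x = z * f x.
  by rewrite -fE /shifted /z !fctE [LHS]addrC subrK.
(* Minimum principle: a negative minimum would satisfy [z * f x0 < f x0 <= P f x0 <= z * f x0]. *)
have f_ge0 x : 0 <= f x.
  pose x0 := [arg min_(i < a) f i]%O.
  have x0P y : f x0 <= f y by rewrite /x0; case: arg_minP => //= i _; exact.
  apply: le_trans (x0P x); rewrite leNgt; apply/negP => fx0.
  have : f x0 <= P f x0.
    rewrite -[X in X <= _]mul1r -(p_sum1 x0) mulr_suml; apply: ler_sum => y _.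
    by rewrite ler_wpM2l.
  have := PfE x0; have : 0 <= atom R a x0 by rewrite ler0n.
  rewrite /z; nra.
have f_gt0 : forall x, 0 < f x.
  apply: (nonneg_gt0 hp hirr (a := a)) => // [|x xa fx].
    rewrite -(pmulr_rgt0 _ z0) -PfE /atom eqxx ltr_wpDl //.
    by apply: sumr_ge0 => y _; rewrite mulr_ge0.
  by have := PfE x; rewrite fx mulr0 /atom (negPf xa) addr0.
pose y := p a b * f b.
have y0 : 0 < y by rewrite mulr_gt0.
have yK : y <= K.
  have := resolvent_pair hp hmu hirr dn0 eta_gt0 ck b fE.
  by rewrite ler_norml => /andP[_]; rewrite lerBlDr KE.
pose w := y / (1 + y).
have y1 : 0 < 1 + y by rewrite addr_gt0.
have w0 : 0 < w by rewrite divr_gt0.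
(* [z ^ t] times [E z ^- s], for [s] the time left until crossing number [k]. *)
pose V t (x : Omega) (s : seq Omega) : R := let j := pair_count a b x s in
  if (k <= j)%N then 1 else z ^+ t * w ^+ (k - j) * (f x / f b).
have C0 t l x : 0 <= z ^+ t * w ^+ l * (f x / f b).
  by apply: mulr_ge0; [apply: mulr_ge0; apply: exprn_ge0; exact: ltW | apply: divr_ge0].
have V0 t x s : 0 <= V t x s by rewrite /V; case: ifP.
have VS t x s : \sum_y0 p x y0 * V t y0 (x :: s) <= V t.+1 x s.
  rewrite /V /=; set j := pair_count a b x s.
  case: (leqP k j) => [kj|jk].
    rewrite -[X in _ <= X](p_sum1 x); apply: ler_sum => v _.
    by rewrite (leq_trans kj) ?leq_addl // mulr1.
  pose C := z ^+ t * w ^+ (k - j) / f b.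
  apply: le_trans (_ : \sum_v C * (p x v * f v + ((x, v) == (a, b))%:R) <= _); last first.
    rewrite -mulr_sumr big_split /= sum_ind -[\sum_i p x i * f i]/(P f x) PfE.
    rewrite /C exprS le_eqVlt; apply/orP; left; apply/eqP; ring.
  apply: ler_sum => v _.
  have [[-> ->]|xv] := eqVneq (x, v) (a, b); last first.
    rewrite add0n leqNgt jk /= addr0 /C le_eqVlt; apply/orP; left; apply/eqP; ring.
  rewrite /= add1n.
  (* By [w * (1 + y) = y], a crossing uses up exactly one factor [w]. *)
  have -> : C * (p a b * f b + 1) = z ^+ t * w ^+ (k - j).-1 * p a b.
    rewrite /C -{1}(prednK (n := k - j)) ?subn_gt0 // exprS /w -/y /y; field.
    by rewrite !gt_eqF //= -/y addrC.
  (* At crossing number [k] the weight is frozen at 1, which is at most [z ^+ t]. *)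
  case: (leqP k j.+1) => kj.
    have -> : (k - j).-1 = 0%N by apply/eqP; rewrite -subnS subn_eq0.
    rewrite expr0 mulr1 mulr1 ler_peMl // exprn_ege1 // /z lerDl ltW //.
  rewrite subnS divff ?gt_eqF // mulr1 mulrC //.
have := path_exp_potential p_ge0 n nu_ge0 VS.
have -> : \sum_x nu x * V n x [::] = z ^+ n * w ^+ k / f b * \sum_x nu x * f x.
  rewrite mulr_sumr; apply: eq_bigr => x _; rewrite /V /= leqn0.
  have -> : (k == 0) = false.
    apply/negbTE; rewrite -lt0n -(ltr0n R); apply: lt_le_trans Kk.
    by rewrite addr_gt0 // (lt_le_trans y0).
  by rewrite subn0; ring.
have wk : w ^+ k / y <= (K / (1 + K)) ^+ k / K.
  by apply: geometric_weight_mono.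
have K0 : 0 < K := lt_le_trans y0 yK.
move=> H; apply: le_trans (_ : _ <= path_exp p nu n (V 0%N)) _.
  by apply: le_path_exp => // x s; move: (V0 0%N x s); rewrite /V; case: ifP.
apply: le_trans H _.
apply: le_trans (_ : z ^+ n * w ^+ k / f b * (r * mean mu f) <= _).
  rewrite ler_wpM2l ?sum_le_mean // !mulr_ge0 ?exprn_ge0 ?invr_ge0 ?(ltW w0) ?(ltW z0) //.
rewrite (mean_resolvent hmu dn0 fE).
(* In terms of [y] alone, monotonicity replaces [y] by [K], and the remaining prefactor
   [(m / d) / K] is at most 1. *)
have -> : z ^+ n * w ^+ k / f b * (r * (mu a / d)) =
    r * (z ^+ n * ((m / d) * (w ^+ k / y))).
  by rewrite /y; field; rewrite !gt_eqF.
rewrite ler_wpM2l ?density_bound_ge0 // ler_wpM2l ?exprn_ge0 ?(ltW z0) //.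
apply: le_trans (ler_wpM2l _ wk) _; first by rewrite divr_ge0 // ltW.
rewrite mulrCA ler_piMr //.
  by rewrite exprn_ge0 // divr_ge0 // ?addr_ge0 // ltW.
by rewrite ler_pdivrMr // mul1r KE lerDr invr_ge0 ltW.
Qed.

(* For [1 - d < 1] the Neumann series diverges.  Positivity is carried over from
   small [d], where the resolvent is close to the large constant [mu a / d]:
   along the way [p a b * u b > 1] prevents [u a] from vanishing. *)
Lemma lower_resolvent (d : R) : 0 < d -> d < eta -> d < 1 ->
  1 < m / d - (eta - d)^-1 ->
  exists2 u, shifted p (- d) (- u) = atom R a & forall x, 0 < u x.
Proof.
move=> d_gt0 d_eta d1 m_big.
have ed : 0 < eta - d by rewrite subr_gt0.
have [U UE] : {U : R -> Omega -> R & forall t, 0 < t <= d ->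
    shifted p (- t) (- U t) = atom R a}.
  apply: (@choice _ _ (fun t f => 0 < t <= d ->
    shifted p (- t) (- f) = atom R a)) => t.
  have [/andP[t0 td]|tI] := boolP (0 < t <= d); last by exists 0.
  have tn0 : - t != 0 by rewrite oppr_eq0 gt_eqF.
  have te : 0 < eta - t by rewrite subr_gt0 (le_lt_trans td).
  have [f fE] := shift_solution hp hmu hirr tn0 te
    (coercive_shift_neg hp hmu hirr (ltW t0)) (atom R a).
  by exists (- f); rewrite opprK.
have PU t x : 0 < t <= d -> P (U t) x = (1 - t) * U t x + atom R a x.
  move=> tI; rewrite -(UE t tI) /shifted markov_actN !fctE /GRing.scale /=.
  by rewrite -/(P (U t) x); ring.
have near t x : 0 < t <= d ->
    `|U t x - mu a / t| <= Num.sqrt (mu a) / (eta - d) / Num.sqrt (mu x).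
  move=> tI; have [t0 td] := andP tI.
  have tn0 : - t != 0 by rewrite oppr_eq0 gt_eqF.
  have te : 0 < eta - t by rewrite subr_gt0 (le_lt_trans td).
  have := resolvent_at hp hmu hirr tn0 te
    (coercive_shift_neg hp hmu hirr (ltW t0)) x (UE t tI).
  rewrite invrN mulrN !fctE -opprD normrN => /le_trans; apply.
  rewrite ler_wpM2r ?invr_ge0 ?sqrtr_ge0 // ler_wpM2l ?sqrtr_ge0 //.
  by rewrite lef_pV2 ?posrE // lerD2l lerN2.
have pU t : 0 < t <= d -> 1 < p a b * U t b.
  move=> tI; have [t0 td] := andP tI.
  have tn0 : - t != 0 by rewrite oppr_eq0 gt_eqF.
  have te : 0 < eta - t by rewrite subr_gt0 (le_lt_trans td).
  have := resolvent_pair hp hmu hirr tn0 te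
    (coercive_shift_neg hp hmu hirr (ltW t0)) b (UE t tI).
  rewrite invrN !mulrN -opprD normrN ler_norml => /andP[+ _].
  have : (eta - t)^-1 <= (eta - d)^-1.
    by rewrite lef_pV2 ?posrE // lerD2l lerN2.
  have : m / d <= m / t by rewrite ler_wpM2l ?(ltW m_gt0) // lef_pV2 ?posrE.
  move: m_big; lra.
have sqrt_gt0 x : 0 < Num.sqrt (mu x) by rewrite sqrtr_gt0.
pose C := \sum_x Num.sqrt (mu a) / (eta - d) / Num.sqrt (mu x).
have Cx x : Num.sqrt (mu a) / (eta - d) / Num.sqrt (mu x) <= C.
  by rewrite /C (bigD1 x) //= lerDl sumr_ge0 // => y _; rewrite !divr_ge0 ?sqrtr_ge0 // ltW.
have C1 : 0 < C + 1.
  by rewrite ltr_wpDl // (le_trans _ (Cx a)) // !divr_ge0 ?sqrtr_ge0 // ltW.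
(* Small enough for [mu a / d0 >= C + 1], where [C] bounds the distance of [U t] from [mu a / t] at
   every state; so [U d0] is positive. *)
pose d0 := Num.min d (mu a / (C + 1)).
have d00 : 0 < d0 by rewrite lt_min d_gt0 divr_gt0.
have d0d : d0 <= d by rewrite ge_min lexx.
have sub t : d0 <= t <= d -> 0 < t <= d.
  by move=> /andP[t0 ->]; rewrite (lt_le_trans d00).
pose B := d0^-1 + (eta - d)^-1.
have B0 : 0 <= B by rewrite addr_ge0 // invr_ge0 ltW.
have bound t h : d0 <= t <= d -> nm h <= B * nm (shifted p (- t) h).
  move=> tI; have /andP[t0 td] := sub t tI; have [d0t _] := andP tI.
  have tn0 : - t != 0 by rewrite oppr_eq0 gt_eqF.
  have te : 0 < eta - t by rewrite subr_gt0 (le_lt_trans td).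
  apply: le_trans (norm_shift hp hmu hirr tn0 te
    (coercive_shift_neg hp hmu hirr (ltW t0)) h) _.
  rewrite ler_wpM2r ?norm_ge0 // normrN gtr0_norm // lerD //.
    by rewrite lef_pV2 ?posrE.
  by rewrite lef_pV2 ?posrE // lerD2l lerN2.
exists (U d); first by apply: UE; rewrite d_gt0 lexx.
apply: (@positive_continuation R Omega U d0 d
  (\sum_x B * (B * Num.sqrt (mu a)) / Num.sqrt (mu x))) => //.
- by apply: sumr_ge0 => x _; rewrite divr_ge0 ?sqrtr_ge0 // mulr_ge0 // mulr_ge0 // sqrtr_ge0.
- move=> t t' x tI tI'.
  pose w := U t - U t'.
  (* Resolvent identity; with the uniform inverse bound [B] it yields the Lipschitz constant. *)
  have wE : shifted p (- t) w = (t - t') *: U t'.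
    apply/funext => y; rewrite /shifted /w markov_actB !fctE /GRing.scale /=.
    rewrite -/(P (U t) y) -/(P (U t') y) !PU ?sub //; ring.
  have U'E : nm (shifted p (- t') (U t')) = Num.sqrt (mu a).
    rewrite -(norm_atom mu a) -(UE t') ?sub // -normN; congr (norm_mu mu _).
    by rewrite /shifted markov_actN scalerN opprB opprK addrC.
  have nw : nm w <= B * (`|t - t'| * (B * Num.sqrt (mu a))).
    apply: le_trans (bound t w tI) _; rewrite ler_wpM2l // wE normZ //.
    by rewrite ler_wpM2l // -U'E bound.
  have xw : `|w x| * Num.sqrt (mu x) <= nm w.
    rewrite -(ler_pM2r (sqrt_gt0 x)) -mulrA -expr2 sqr_sqrtr // mulrC.
    rewrite -{1}[mu x]ger0_norm // -normrM -inner_atom.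
    rewrite [leRHS]mulrC -(norm_atom mu x) ler_norml inner_le_norm // andbT.
    by rewrite lerNl -innerNr -(normN _ w) inner_le_norm.
  have : `|w x| <= B * (B * Num.sqrt (mu a)) / Num.sqrt (mu x) * `|t - t'|.
    rewrite mulrAC ler_pdivlMr //; apply: le_trans xw (le_trans nw _).
    by rewrite le_eqVlt; apply/orP; left; apply/eqP; ring.
  move/le_trans; apply; rewrite ler_wpM2r // (bigD1 x) //= lerDl.
  by apply: sumr_ge0 => y _; rewrite divr_ge0 ?sqrtr_ge0 // mulr_ge0 // mulr_ge0 // sqrtr_ge0.
- move=> x; have d0I : 0 < d0 <= d by rewrite d00.
  have := near d0 x d0I; rewrite ler_norml => /andP[+ _].
  have : C + 1 <= mu a / d0.
    by rewrite ler_pdivlMr // mulrC -ler_pdivlMr // ge_min lexx orbT.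
  have := Cx x; lra.
- move=> t tI U0; have tI' := sub t tI; have [t0 td] := andP tI'.
  have t1 : 0 < 1 - t by rewrite subr_gt0 (le_lt_trans td).
  apply: (nonneg_gt0 hp hirr (a := a)) => // [|x xa Ux].
    (* At [a]: [(1 - t) * U t a = P (U t) a - 1 >= p a b * U t b - 1 > 0]. *)
    rewrite -(pmulr_rgt0 _ t1); have := PU t a tI'.
    rewrite /atom eqxx; have := pU t tI'.
    have : p a b * U t b <= P (U t) a.
      rewrite /markov_act (bigD1 b) //= lerDl; apply: sumr_ge0 => y _.
      by rewrite mulr_ge0.
    move=> /=; lra.
  by rewrite PU // Ux mulr0 /atom (negPf xa) addr0.
Qed.

(** Mirror image of the upper tail: [E * u x / u b] is the mean of [l^-s] for the next crossing, and
    paths with more than [k] crossings get weight 0. [W] bounds [Y - 1] from below, so that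
    [E = 1 + (Y - 1)^-1 <= 1 + W^-1]. *)
Lemma lower_tail (d W : R) n k : 0 < d -> d < eta -> d < 1 ->
  W <= m / d - (eta - d)^-1 - 1 -> 0 < W ->
  path_exp p nu n (fun x s => ((pair_count a b x s <= k)%N)%:R)
    <= r * ((1 - d) ^+ n * ((1 + W^-1) ^+ k * (m / d / W))).
Proof.
move=> d0 de d1 WE W0.
have dn0 : - d != 0 by rewrite oppr_eq0 gt_eqF.
have ed : 0 < eta - d by rewrite subr_gt0.
have [u uE u_gt0] : exists2 u, shifted p (- d) (- u) = atom R a & forall x, 0 < u x.
  by apply: lower_resolvent => //; lra.
pose l := 1 - d.
have l0 : 0 < l by rewrite subr_gt0.
have PuE x : P u x - atom R a x = l * u x.
  rewrite -uE /shifted markov_actN !fctE /GRing.scale /=.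
  by rewrite -/(P u x) /l; ring.
pose Y := p a b * u b.
have YW : W + 1 <= Y.
  have := resolvent_pair hp hmu hirr dn0 ed
    (coercive_shift_neg hp hmu hirr (ltW d0)) b uE.
  rewrite invrN !mulrN -opprD normrN ler_norml => /andP[+ _].
  rewrite /Y; lra.
have Y1 : 0 < Y - 1 by lra.
have Y0 : 0 < Y by lra.
pose E := Y / (Y - 1).
have E0 : 0 < E by rewrite divr_gt0.
(* A crossing takes at least one step, so [l] times the mean of [l^-s] is at least 1; this is why
   [V] carries [l ^+ t.+1]. Away from [a] one has [P u = l * u < u], so the minimum is at [a], where
   one step is computed. *)
have u_min x : u b <= l * E * u x.
  pose x0 := [arg min_(i < a) u i]%O.
  have x0P y : u x0 <= u y by rewrite /x0; case: arg_minP => //= i _; exact.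
  have x0a : x0 = a.
    apply/eqP/negPn/negP => xa.
    have : u x0 <= P u x0.
      rewrite -[X in X <= _]mul1r -(p_sum1 x0) mulr_suml; apply: ler_sum => y _.
      by rewrite ler_wpM2l.
    have := PuE x0; rewrite /atom (negPf xa) subr0 => -> .
    by have := u_gt0 x0; rewrite /l; nra.
  apply: le_trans (_ : l * E * u a <= _); last first.
    by rewrite ler_pM2l -?x0a //; exact: mulr_gt0.
  have Pua : (1 - p a b) * u a + p a b * u b <= P u a.
    rewrite /markov_act (bigD1 b) //= [leLHS]addrC lerD2l.
    have -> : 1 - p a b = \sum_(y | y != b) p a y.
      by rewrite -(p_sum1 a) (bigD1 b) //= addrAC subrr add0r.
    by rewrite mulr_suml; apply: ler_sum => y _; rewrite ler_wpM2l // -x0a.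
  have := PuE a; rewrite /atom eqxx /= => Ea.
  have p1 := transition_le1 hp a b.
  have : Y - 1 <= l * p a b * u a.
    have : 0 <= d * (1 - p a b) * u a.
      by rewrite mulr_ge0 ?(ltW (u_gt0 a)) // mulr_ge0 ?(ltW d0) // subr_ge0.
    by move: Ea Pua; rewrite /Y /l; nra.
  move=> H; rewrite -(ler_pM2l pab) -/Y /E.
  have -> : p a b * (l * (Y / (Y - 1)) * u a) = Y / (Y - 1) * (l * p a b * u a) by ring.
  by rewrite mulrAC ler_pdivlMr // ler_pM2l.
(* [l ^ t.+1] times [E l ^- s], for [s] the time left until crossing [k.+1]. *)
pose V t (x : Omega) (s : seq Omega) : R := let j := pair_count a b x s in
  if (j <= k)%N then l ^+ t.+1 * E ^+ (k.+1 - j) * (u x / u b) else 0.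
have C0 t j x : 0 <= l ^+ t * E ^+ j * (u x / u b).
  apply: mulr_ge0; last by apply: divr_ge0; exact: ltW.
  by apply: mulr_ge0; apply: exprn_ge0; exact: ltW.
have VS t x s : \sum_y p x y * V t y (x :: s) <= V t.+1 x s.
  rewrite /V /=; set j := pair_count a b x s.
  case: (leqP j k) => [jk|kj]; last first.
    rewrite big1 // => v _; rewrite leqNgt (leq_trans kj) ?leq_addl //=.
    by rewrite mulr0.
  pose C := l ^+ t.+1 * E ^+ (k.+1 - j) / u b.
  apply: le_trans (_ : \sum_v C * (p x v * u v - ((x, v) == (a, b))%:R) <= _); last first.
    rewrite -mulr_sumr sumrB sum_ind -[\sum_i p x i * u i]/(P u x) PuE.
    rewrite /C (exprS l t.+1) le_eqVlt; apply/orP; left; apply/eqP; ring.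
  apply: ler_sum => v _.
  have [[-> ->]|xv] := eqVneq (x, v) (a, b); last first.
    rewrite add0n jk /= subr0 /C le_eqVlt; apply/orP; left; apply/eqP; ring.
  rewrite /= add1n subSS.
  (* By [E * (Y - 1) = Y], a crossing uses up one factor [E]. *)
  have -> : C * (p a b * u b - 1) = l ^+ t.+1 * E ^+ (k - j) * p a b.
    rewrite /C subSn // (exprS E) -/Y; set e := E ^+ (k - j).
    rewrite /E; rewrite /Y in Y1 *; field.
    by rewrite !gt_eqF.
  case: (leqP j.+1 k) => kj; last first.
    by rewrite mulr0 mulr_ge0 // mulr_ge0 // exprn_ge0 // ltW.
  by rewrite divff ?gt_eqF // mulr1 mulrC.
have := path_exp_potential p_ge0 n nu_ge0 VS.
have -> : \sum_x nu x * V n x [::] = l ^+ n.+1 * E ^+ k.+1 / u b * \sum_x nu x * u x.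
  rewrite mulr_sumr; apply: eq_bigr => x _; rewrite /V /= subn0; ring.
move=> H; apply: le_trans (_ : _ <= path_exp p nu n (V 0%N)) _.
  apply: le_path_exp => // x s; rewrite /V; case: leqP => // jk.
  rewrite subSn // !exprS expr0 mulr1.
  have E1 : 1 <= E by rewrite ler_pdivlMr // mul1r lerBlDr lerDl.
  have : 1 <= l * E * (u x / u b) by rewrite mulrA ler_pdivlMr // mul1r.
  have : 1 <= E ^+ (k - pair_count a b x s) by exact: exprn_ege1.
  set e := E ^+ _ => e1 c1.
  have -> : l * (E * e) * (u x / u b) = e * (l * E * (u x / u b)) by ring.
  by rewrite mulr_ege1.
apply: le_trans H _.
apply: le_trans (_ : l ^+ n.+1 * E ^+ k.+1 / u b * (r * mean mu u) <= _).
  rewrite ler_wpM2l ?sum_le_mean // => [|x]; last exact: ltW.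
  by rewrite !mulr_ge0 ?exprn_ge0 ?invr_ge0 ?(ltW E0) ?(ltW l0) ?(ltW (u_gt0 b)).
have mu_u : mean mu u = mu a / d.
  by have := mean_resolvent hmu dn0 uE; rewrite meanN invrN mulrN => /oppr_inj.
rewrite mu_u.
have -> : l ^+ n.+1 * E ^+ k.+1 / u b * (r * (mu a / d)) =
    r * (l ^+ n * (E ^+ k * (l * (m / d / (Y - 1))))).
  by rewrite !exprS /E -/Y /Y; field; rewrite !gt_eqF //= -/Y.
rewrite ler_wpM2l ?density_bound_ge0 // ler_wpM2l ?exprn_ge0 ?(ltW l0) //.
have md : 0 <= m / d by rewrite divr_ge0 // ltW.
apply: ler_pM.
- by rewrite exprn_ge0 // ltW.
- by rewrite mulr_ge0 ?(ltW l0) // divr_ge0 // ltW.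
- apply: lerXn2r; rewrite ?nnegrE ?addr_ge0 ?invr_ge0 ?(ltW E0) ?(ltW W0) //.
  have -> : E = 1 + (Y - 1)^-1 by rewrite /E; field; rewrite gt_eqF.
  by rewrite lerD2l lef_pV2 ?posrE // lerBrDr.
- apply: le_trans (_ : m / d / (Y - 1) <= _).
    by apply: ler_piMl; [exact: divr_ge0 md (ltW Y1) | rewrite gerBl ltW].
  by rewrite ler_wpM2l // lef_pV2 ?posrE // lerBrDr.
Qed.

End Tails.

(** * Choice of the parameters and the resulting exponents *)

Section Calculus.
Variable R : realType.
Implicit Types (d e g K m s t w x y : R).

Lemma exprn_le_expR x n : 0 <= 1 + x -> (1 + x) ^+ n <= expR (n%:R * x).
Proof.
move=> x0; rewrite mulrC expRM_natr; apply: lerXn2r; rewrite ?nnegrE ?expR_ge0 //.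
exact: expR_ge1Dx.
Qed.

(** With [1 + x <= exp x] for both powers, the exponent is at most [n d - n (m + t) / (1 + K) = - n
    g t^2 / (2 (t + 2 m))]. *)
Lemma upper_exponent e g m s t n k : 0 < e -> g = e / (1 + e) -> 0 < m <= 1 ->
  0 < t -> 0 < s -> 4 * m + t ^+ 2 <= s ^+ 2 ->
  1 / 2 < n%:R * g * t ^+ 2 / (4 * s) -> n%:R * (m + t) <= k%:R ->
  let d := g * t / 2 in let K := e^-1 + m / d in
  K + 1 <= k%:R /\
  (1 + d) ^+ n * (K / (1 + K)) ^+ k <= expR (- (n%:R * g * t ^+ 2 / (4 * s))).
Proof.
move=> e0 gE /andP[m0 m1] t0 s0 s2 X kn d K.
have e1 : 0 < 1 + e by rewrite addr_gt0.
have g0 : 0 < g by rewrite gE divr_gt0.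
have d0 : 0 < d by rewrite /d divr_gt0 // mulr_gt0.
have gt0 : 0 < g * t by rewrite mulr_gt0.
have K0 : 0 < K by rewrite /K addr_gt0 ?invr_gt0 // divr_gt0.
(* Here [1 + e^-1 = g^-1], which is where [gamma] comes from. *)
have KE : 1 + K = (t + 2 * m) / (g * t).
  by rewrite /K /d gE; field; rewrite !gt_eqF.
have st : t <= s by rewrite -ler_sqr ?nnegrE ?ltW //; nra.
have n0 : 0 <= n%:R :> R by rewrite ler0n.
move: X; set N := n%:R in n0 kn *; rewrite ltr_pdivlMr ?mulr_gt0 // => X.
(* From [N g t^2 > 2 s] and [s >= t]; it makes [k] large enough for [geometric_weight_mono]. *)
have Ngt : 2 <= N * (g * t).
  rewrite -(ler_pM2r t0); have -> : N * (g * t) * t = N * g * t ^+ 2 by ring.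
  lra.
split.
  apply: le_trans kn; rewrite addrC KE ler_pdivrMr //.
  have -> : N * (m + t) * (g * t) = N * (g * t) * (m + t) by ring.
  apply: le_trans (_ : 2 * (m + t) <= _); first by lra.
  by rewrite ler_pM2r // addr_gt0.
have H1 : (1 + d) ^+ n <= expR (N * d) by apply: exprn_le_expR; rewrite addr_ge0 // ltW.
have K1 : 0 < 1 + K by rewrite addr_gt0.
have H2 : (K / (1 + K)) ^+ k <= expR (k%:R * (- (1 + K)^-1)).
  have -> : K / (1 + K) = 1 + - (1 + K)^-1 by field; rewrite gt_eqF.
  apply: exprn_le_expR; have -> : 1 + - (1 + K)^-1 = K / (1 + K) by field; rewrite gt_eqF.
  by rewrite divr_ge0 // ltW.
have H3 : 0 <= (1 + d) ^+ n by rewrite exprn_ge0 // addr_ge0 // ltW.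
have H4 : 0 <= (K / (1 + K)) ^+ k by rewrite exprn_ge0 // divr_ge0 // ltW.
apply: le_trans (ler_pM H3 H4 H1 H2) _.
rewrite -expRD ler_expR mulrN lerBlDr -lerBlDl opprK.
apply: le_trans (_ : N * (m + t) * (1 + K)^-1 <= _); last first.
  by rewrite ler_wpM2r // invr_ge0 ltW.
have tm : 0 < t + 2 * m by rewrite addr_gt0 // mulr_gt0.
rewrite KE invf_div.
have -> : N * (m + t) * (g * t / (t + 2 * m)) =
  N * d + N * g * t ^+ 2 * (2 * (t + 2 * m))^-1.
  by rewrite /d; field; rewrite gt_eqF.
rewrite lerD2l ler_wpM2l //.
  by rewrite mulr_ge0 ?sqr_ge0 // mulr_ge0 // ltW.
rewrite lef_pV2 ?posrE ?mulr_gt0 //.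
(* In squares: [(t + 2 m)^2 <= 3 t^2 + 6 m^2 <= 4 t^2 + 16 m], as [m <= 1]. *)
have : t + 2 * m <= 2 * s.
  rewrite -ler_sqr ?nnegrE ?mulr_ge0 ?(ltW tm) ?(ltW s0) //.
  have : (t - m) ^+ 2 >= 0 by exact: sqr_ge0.
  nra.
lra.
Qed.

(** The two powers give a surplus factor [1 + 3 w] in the exponent, with [w = y / m]; it pays for
    the prefactor [m / d / W = (1 - w)^-1 <= exp (3 w / 2)]. *)
Lemma lower_exponent e g m s t n k : 0 < e -> g = e / (1 + e) -> m <= 1 ->
  0 < t <= m -> 0 < s -> 4 * m + t ^+ 2 <= s ^+ 2 ->
  1 / 2 < n%:R * g * t ^+ 2 / (4 * s) -> k%:R <= n%:R * (m - t) ->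
  let d := g * t / 4 in let W := (m - t / (4 - t)) / d in
  [/\ 0 < d < e, d < 1, 0 < W, W <= m / d - (e - d)^-1 - 1 &
  (1 - d) ^+ n * ((1 + W^-1) ^+ k * (m / d / W)) <=
    expR (- (n%:R * g * t ^+ 2 / (4 * s)))].
Proof.
move=> e0 gE m1 /andP[t0 tm] s0 s2 X kn d W.
have m0 : 0 < m := lt_le_trans t0 tm.
have e1 : 0 < 1 + e by rewrite addr_gt0.
have g0 : 0 < g by rewrite gE divr_gt0.
have gE' : g * (1 + e) = e by rewrite gE divfK // gt_eqF.
have g1 : g < 1 by rewrite gE ltr_pdivrMr // mul1r ltrDr.
have ge : g < e by rewrite -gE' ltr_pMr // ltrDl.
have d0 : 0 < d by rewrite /d divr_gt0 // mulr_gt0.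
have dg : d < g by rewrite /d; nra.
have t4 : 0 < 4 - t by lra.
pose y := t / (4 - t); rewrite -/y in W *.
have y3 : 3 * y <= t by rewrite /y mulrA ler_pdivrMr //; nra.
have y0 : 0 < y by rewrite divr_gt0.
have my : 0 < m - y by lra.
have W0 : 0 < W by rewrite /W divr_gt0.
have ed : 0 < e - d by lra.
(* With [x = t / 4], the correction [d ((e - d)^-1 + 1)] is [x (1 + e - g x) / (1 + e - x)], at most
   [x / (1 - x) = t / (4 - t)], which no longer involves [e]. *)
have WE : W <= m / d - (e - d)^-1 - 1.
  have -> : m / d - (e - d)^-1 - 1 = (m - d * (1 + e - d) / (e - d)) / d.
    by field; rewrite !gt_eqF.
  rewrite ler_pM2r ?invr_gt0 // lerD2l lerN2 ler_pdivrMr // /y [leRHS]mulrAC ler_pdivlMr //.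
  have {2}-> : e = g * (1 + e) by [].
  pose x := t / 4; have -> : d = g * x by rewrite /x /d mulrA.
  have xE : t = 4 * x by rewrite /x; field.
  rewrite xE in t4 *.
  have x0 : 0 < x by lra.
  have : (1 + e - g * x) * (1 - x) <= 1 + e - x.
    have : 0 <= e * x by rewrite mulr_ge0 // ltW.
    have : 0 <= g * x * (1 - x) by rewrite mulr_ge0 ?mulr_ge0 ?(ltW g0) ?(ltW x0) //; lra.
    nra.
  have gx : 0 <= 4 * (g * x) by rewrite mulr_ge0 // mulr_ge0 // ltW.
  move=> /(ler_wpM2l gx); nra.
split => //; [by rewrite d0; lra|lra|].
set N := n%:R in X kn *.
have W1 : 0 < W^-1 by rewrite invr_gt0.
pose w := y / m.
have w0 : 0 < w by rewrite divr_gt0.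
have w3 : w <= 1 / 3 by rewrite /w ler_pdivrMr //; lra.
have H1 : (1 - d) ^+ n <= expR (N * (- d)) by apply: exprn_le_expR; lra.
have H2 : (1 + W^-1) ^+ k <= expR (k%:R * W^-1).
  by apply: exprn_le_expR; rewrite addr_ge0 // ltW.
have H3 : m / d / W <= expR (3 / 2 * w).
  have -> : m / d / W = (1 - w)^-1.
    rewrite /W /w; field; rewrite !gt_eqF //=; lra.
  apply: le_trans (expR_ge1Dx _).
  rewrite -[leLHS]mul1r ler_pdivrMr; last by lra.
  nra.
have H4 : 0 <= m / d / W by apply: divr_ge0 (ltW W0); apply: divr_ge0; exact: ltW.
have H5 : 0 <= (1 + W^-1) ^+ k by rewrite exprn_ge0 // addr_ge0 // ltW.
have H6 : 0 <= (1 - d) ^+ n by rewrite exprn_ge0 // subr_ge0 (ltW (lt_trans dg g1)).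
apply: le_trans (ler_pM H6 (mulr_ge0 H5 H4) H1 (ler_pM H5 H4 H2 H3)) _.
rewrite -!expRD ler_expR.
have n0 : 0 <= N by rewrite ler0n.
have kW : k%:R * W^-1 <= N * (m - t) * (d / (m - y)).
  by rewrite /W invf_div ler_wpM2r // divr_ge0 // ltW.
have E1 : N * (m - t) * (d / (m - y)) = N * d - N * d * ((t - y) / (m - y)).
  by field; rewrite gt_eqF.
have s2m : 2 * m <= s.
  by rewrite -ler_sqr ?nnegrE ?mulr_ge0 ?(ltW m0) ?(ltW s0) //; nra.
(* Combines [t - y >= 2 t / 3], [s >= 2 m] and [(1 + 3 w) (1 - w) <= 4 / 3]. *)
have key : (1 + 3 * w) * (N * g * t ^+ 2 / (4 * s)) <= N * d * ((t - y) / (m - y)).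
  have -> : (1 + 3 * w) * (N * g * t ^+ 2 / (4 * s)) = N * d * ((1 + 3 * w) * t / s).
    by rewrite /d; field; rewrite gt_eqF.
  apply: ler_wpM2l; first by rewrite mulr_ge0 // ltW.
  rewrite ler_pdivrMr // mulrAC ler_pdivlMr //.
  have -> : (1 + 3 * w) * t * (m - y) = t * m * ((1 + 3 * w) * (1 - w)).
    by rewrite /w; field; rewrite gt_eqF.
  apply: le_trans (_ : t * m * (4 / 3) <= _).
    by rewrite ler_wpM2l ?mulr_ge0 ?(ltW t0) ?(ltW m0) //; nra.
  apply: le_trans (_ : (2 / 3 * t) * (2 * m) <= _); first by lra.
  by rewrite ler_pM //; lra.
(* As [XX > 1 / 2], the surplus [3 w XX] exceeds [3 w / 2]. *)
move: key; set XX := N * g * t ^+ 2 / (4 * s) in X *.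
nra.
Qed.

End Calculus.

(** * Two-sided deviation bound for path expectations *)

Section Concentration.
Variables (R : realType) (Omega : finType).
Variables (p : Omega -> Omega -> R) (mu nu : Omega -> R).
Hypotheses (hp : transition_matrix p) (hmu : invariant_distribution p mu).
Hypothesis hirr : irreducible_transition p.
Hypothesis hOmega : (2 <= #|Omega|)%N.
Hypothesis hnu : distribution_on nu.
Variable r : R.
Hypothesis nu_le : forall x, nu x <= r * mu x.
Local Notation eta := (poincare_gap p mu).
Local Notation gam := (gamma_gap p mu).

Let mu_gt0 u : 0 < mu u. Proof. exact: (invariant_gt0 hp hmu hirr). Qed.
Let p_ge0 u v : 0 <= p u v. Proof. by case: (hp u). Qed.
Let p_sum1 u : \sum_v p u v = 1. Proof. by case: (hp u). Qed.
Let nu_ge0 u : 0 <= nu u. Proof. by case: hnu. Qed.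
Let eta_gt0 : 0 < eta. Proof. exact: (poincare_gap_gt0 hp hmu hirr hOmega). Qed.

Lemma density_bound_ge1 : 1 <= r.
Proof.
rewrite -[r]mulr1 -[X in _ * X]hmu.1.2 -hnu.2 mulr_sumr.
by apply: ler_sum.
Qed.

Lemma gamma_gap_gt0 : 0 < gam.
Proof. by rewrite divr_gt0 // addr_gt0. Qed.

Lemma path_exp_cst n (c : R) : path_exp p nu n (fun _ _ => c) = c.
Proof.
elim: n => [|n IH] /=; first by rewrite -mulr_suml hnu.2 mul1r.
rewrite -[RHS]IH; congr path_exp; apply/funext => x; apply/funext => s.
by rewrite -mulr_suml p_sum1 mul1r.
Qed.

(** Covers the pairs that are never crossed, to which the renewal argument does not apply. *)
Lemma path_exp_null a b n : p a b = 0 ->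
  path_exp p nu n (fun x s => (0 < pair_count a b x s)%N%:R) <= 0.
Proof.
move=> pab.
pose V (_ : nat) (x : Omega) (s : seq Omega) : R := (0 < pair_count a b x s)%N%:R.
have VS t x s : \sum_y p x y * V t y (x :: s) <= V t.+1 x s.
  rewrite -[leRHS]mul1r -(p_sum1 x) mulr_suml; apply: ler_sum => y _.
  rewrite /V /=; have [[-> ->]|_] := eqVneq (x, y) (a, b); first by rewrite pab !mul0r.
  by rewrite add0n.
have := path_exp_potential p_ge0 n nu_ge0 VS.
by rewrite [X in _ <= X -> _]big1 // => x _; rewrite /V mulr0.
Qed.

Lemma pair_freq_tail a b n (t : R) : (0 < n)%N -> 0 < t ->
  path_exp p nu n (fun x s =>
    (t <= `|n%:R^-1 * (pair_count a b x s)%:R - mu a * p a b|)%R%:R)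
  <= 2 * r * expR (- (n%:R * gam * t ^+ 2) /
       (4 * Num.sqrt ((2 + 6 * gam) ^+ 2 * (mu a * p a b) + t ^+ 2))).
Proof.
move=> n0 t0; set m := mu a * p a b; set s := Num.sqrt _.
set X := _ / (4 * s).
have r1 := density_bound_ge1; have r0 : 0 <= r by lra.
have n0' : 0 < n%:R :> R by rewrite ltr0n.
have g0 := gamma_gap_gt0.
have [|Xlt] := lerP (1 / 2) (expR X).
  move=> X2; apply: le_trans (_ : path_exp p nu n (fun _ _ => 1) <= _).
    by apply: le_path_exp => // x l; rewrite lern1 leq_b1.
  rewrite path_exp_cst; nra.
have m0 : 0 <= m by rewrite mulr_ge0 // ltW.
have := p_ge0 a b; rewrite le_eqVlt => /predU1P[pab0|pab].
  apply: le_trans (_ : 0 <= _); last by rewrite mulr_ge0 ?expR_ge0 // mulr_ge0.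
  apply: le_trans (path_exp_null n (esym pab0)).
  apply: le_path_exp => // x l; rewrite /m -pab0 mulr0 subr0.
  by case: posnP => [->|_]; rewrite ?mulr0 ?normr0 ?(lt_geF t0) // ler_nat leq_b1.
have m_gt0 : 0 < m by rewrite mulr_gt0.
have m1 : m <= 1.
  rewrite -[leRHS]mulr1 ler_pM ?(ltW (mu_gt0 a)) //.
    exact: distribution_le1 hmu.1.
  exact: transition_le1.
(* Only [(2 + 6 gam)^2 >= 4] enters. *)
have s2 : 4 * m + t ^+ 2 <= s ^+ 2.
  rewrite sqr_sqrtr; last by rewrite addr_ge0 ?sqr_ge0 // mulr_ge0 ?sqr_ge0.
  rewrite lerD2r ler_wpM2r //; nra.
have s0 : 0 < s.
  by rewrite sqrtr_gt0 ltr_wpDl ?exprn_gt0 // mulr_ge0 ?sqr_ge0.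
have XE : X = - (n%:R * gam * t ^+ 2 / (4 * s)) by rewrite /X mulNr.
(* From [1 + X <= expR X < 1 / 2]. *)
have X2 : 1 / 2 < n%:R * gam * t ^+ 2 / (4 * s).
  have := expR_ge1Dx X; rewrite XE in Xlt *; lra.
have up : path_exp p nu n (fun x l => (n%:R * (m + t) <= (pair_count a b x l)%:R)%R%:R)
    <= r * expR X.
  have exk : exists j, n%:R * (m + t) <= j%:R.
    by exists (Num.truncn (n%:R * (m + t))).+1; rewrite ltW // real_truncnS_gt ?num_real.
  case: (ex_minnP exk) => k km kmin.
  have m01 : 0 < m <= 1 by rewrite m_gt0.
  have [Kk HX] := upper_exponent eta_gt0 (erefl gam) m01 t0 s0 s2 X2 km.
  have d0 : 0 < gam * t / 2 by rewrite divr_gt0 // mulr_gt0.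
  have := upper_tail hp hmu hirr hOmega nu_ge0 nu_le pab n d0 erefl Kk.
  move=> H; apply: le_trans (le_trans H _); last by rewrite XE ler_wpM2l.
  apply: le_path_exp => // x l; case: (lerP _ (pair_count a b x l)%:R) => [/kmin ->|_] //.
have low : path_exp p nu n (fun x l => ((pair_count a b x l)%:R <= n%:R * (m - t))%R%:R)
    <= r * expR X.
  (* For [t > m] the lower deviation would require a negative count. *)
  have [tm|mt] := lerP t m; last first.
    apply: le_trans (_ : path_exp p nu n (fun _ _ => 0) <= _).
      have neg : n%:R * (m - t) < 0 by rewrite pmulr_rlt0 // subr_lt0.
      by apply: le_path_exp => // x l; rewrite [_ <= _ * _]leNgt (lt_le_trans neg (ler0n _ _)).
    by rewrite path_exp_cst mulr_ge0 // expR_ge0.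
  pose k := Num.truncn (n%:R * (m - t)).
  have nmt : 0 <= n%:R * (m - t) by rewrite mulr_ge0 // subr_ge0.
  have km : k%:R <= n%:R * (m - t) by rewrite truncn_le.
  have t0m : 0 < t <= m by rewrite t0.
  have [/andP[d0 de] d1 W0 WE HX] :=
    lower_exponent eta_gt0 (erefl gam) m1 t0m s0 s2 X2 km.
  have := lower_tail hp hmu hirr hOmega nu_ge0 nu_le pab n k d0 de d1 WE W0.
  move=> H; apply: le_trans (le_trans H _); last by rewrite XE ler_wpM2l.
  by apply: le_path_exp => // x l; rewrite -(truncn_ge_nat _ nmt).
have -> : 2 * r * expR X = r * expR X + r * expR X by ring.
apply: le_trans (lerD up low); rewrite -path_expD.
apply: le_path_exp => // x l; set c := (pair_count a b x l)%:R.
case: (lerP t) => [|_]; last by rewrite addr_ge0 ?ler0n.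
have cE : c = n%:R * (n%:R^-1 * c) by rewrite mulrA divff ?mul1r // gt_eqF.
have lec y : (n%:R * y <= c) = (y <= n%:R^-1 * c) by rewrite [in LHS]cE ler_pM2l.
have gec y : (c <= n%:R * y) = (n%:R^-1 * c <= y) by rewrite [in LHS]cE ler_pM2l.
rewrite lec gec ler_normr => /orP[zt|zt].
- have -> : m + t <= n%:R^-1 * c by lra.
  by rewrite lerDl ler0n.
- have -> : n%:R^-1 * c <= m - t by lra.
  by rewrite lerDr ler0n.
Qed.

End Concentration.

(** * From the chain to trajectories *)

Lemma integral_finite d (T : measurableType d) (R : realType)
    (Pr : probability T R) (I : finType) (X : T -> I) (g : I -> R) :
  (forall i, measurable (X @^-1` [set i])) -> (forall i, 0 <= g i) ->
  (\int[Pr]_w (g (X w))%:E = \sum_i (g i)%:E * Pr (X @^-1` [set i]))%E.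
Proof.
move=> mX g0.
transitivity (\int[Pr]_w (\sum_i (g i)%:E * (\1_(X @^-1` [set i]) w)%:E))%E.
  apply: eq_integral => w _; rewrite (bigD1 (X w)) //= big1 ?adde0 => [|i iX].
    by rewrite indicE mem_set // mule1.
  by rewrite indicE memNset ?mule0 //= => Xi; rewrite Xi eqxx in iX.
rewrite ge0_integral_sum //=.
- apply: eq_bigr => i _; rewrite ge0_integralZl_EFin //.
  + by rewrite integral_indic // setIT.
  + exact/measurable_EFinP/measurable_indic.
- move=> i; apply: measurable_funeM; exact/measurable_EFinP/measurable_indic.
- by move=> i w _; rewrite mule_ge0 ?lee_fin.
Qed.

Section Chain.
Variables (d : measure_display) (T : measurableType d) (R : realType).
Variables (Pr : probability T R) (Omega : finType).
Variables (p : Omega -> Omega -> R) (nu : Omega -> R) (u : nat -> T -> Omega).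
Hypothesis hp : transition_matrix p.
Hypothesis hu : markov_chain Pr p nu u.

Let p_ge0 x y : 0 <= p x y. Proof. by case: (hp x). Qed.

Fixpoint past (x : nat -> Omega) n : seq Omega :=
  if n is n'.+1 then x n' :: past x n' else [::].

Lemma eq_past (x y : nat -> Omega) n : (forall i, (i < n)%N -> x i = y i) ->
  past x n = past y n.
Proof.
elim: n => //= n IH xy; rewrite xy // IH // => i ni; apply: xy; exact: ltnW.
Qed.

(** Turns a finite history into the infinite sequence that [trajectory] expects; values after time
    [n] are defaults and are never inspected. *)
Let extend n (f : {ffun 'I_n.+1 -> Omega}) (i : nat) : Omega := f (inord i).
Let history n (w : T) : {ffun 'I_n.+1 -> Omega} := [ffun i : 'I_n.+1 => u i w].

Let historyP n w i : (i <= n)%N -> extend (history n w) i = u i w.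
Proof. by move=> ni; rewrite /extend ffunE inordK. Qed.

Lemma measurable_trajectory x n : measurable (trajectory u x n).
Proof.
have [mu _ _] := hu; elim: n => [|n IH].
  rewrite (_ : trajectory u x 0 = u 0%N @^-1` [set x 0%N]) //.
  apply/seteqP; split => [w /(_ 0%N)|w /= w0 i]; first exact.
  by rewrite leqn0 => /eqP ->.
rewrite (_ : trajectory u x n.+1 = trajectory u x n `&` u n.+1 @^-1` [set x n.+1]).
  exact: measurableI.
apply/seteqP; split => [w xw|w [xw wn] i].
  by split=> [i ni|]; apply: xw => //; exact: leqW.
by rewrite leq_eqVlt ltnS => /predU1P[->|/xw].
Qed.

Let historyE n f : history n @^-1` [set f] = trajectory u (extend f) n.
Proof.
apply/seteqP; split => [w /= <- i ni|w /= wf]; first by rewrite historyP.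
by apply/ffunP => i; rewrite ffunE wf -1?ltnS // /extend inord_val.
Qed.

(** Multiplicative form of the Markov property, valid for null trajectories too, where [cond_prob]
    is unspecified and both sides vanish. *)
Lemma trajectory_step x n y :
  Pr (trajectory u x n `&` u n.+1 @^-1` [set y]) =
  ((p (x n) y)%:E * Pr (trajectory u x n))%E.
Proof.
have [mu _ mk] := hu.
(* The property is stated along one sequence, so the next state [y] is built into it. *)
pose x' i := if (i <= n)%N then x i else y.
have x'n : trajectory u x' n = trajectory u x n.
  by apply/seteqP; split => w xw i ni; have := xw i ni; rewrite /x' ni.
have mt := measurable_trajectory x n.
have mI : measurable (trajectory u x n `&` u n.+1 @^-1` [set y]) by exact: measurableI.
have [P0|P0] := eqVneq (Pr (trajectory u x n)) 0%E.
  rewrite P0 mule0; apply/eqP; rewrite eq_le measure_ge0 andbT -P0.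
  by apply: le_measure; rewrite ?inE //; exact: subIsetl.
have := mk x' n; rewrite x'n => /(_ P0); rewrite /cond_prob /x' leqnn ltnn.
have Pf : Pr (trajectory u x n) \is a fin_num by exact: fin_num_measure.
have If : Pr (trajectory u x n `&` u n.+1 @^-1` [set y]) \is a fin_num.
  exact: fin_num_measure.
have f0 : fine (Pr (trajectory u x n)) != 0 by rewrite fine_eq0.
move=> <-; rewrite -[in RHS](fineK Pf) -EFinM divfK //.
by rewrite setIC fineK // setIC.
Qed.

(** By induction on [n]: the pair of history and next state takes finitely many values, and
    [trajectory_step] integrates out the last one. *)
Lemma path_integral n (F : Omega -> seq Omega -> R) : (forall x s, 0 <= F x s) ->
  (\int[Pr]_w (F (u n w) (past (u^~ w) n))%:E = (path_exp p nu n F)%:E)%E.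
Proof.
have [mu init _] := hu.
elim: n F => [|n IH] F F0 /=.
  rewrite (@integral_finite _ T R Pr _ (u 0%N) (F^~ [::])) // -sumEFin.
  by apply: eq_bigr => x _; rewrite init muleC.
rewrite -IH => [|x s]; last by apply: sumr_ge0 => y _; rewrite mulr_ge0.
pose g (f : {ffun 'I_n.+1 -> Omega}) y := F y (extend f n :: past (extend f) n).
have pastE w : past (u^~ w) n = past (extend (history n w)) n.
  by apply: eq_past => i ni; rewrite historyP // ltnW.
transitivity (\int[Pr]_w (g (history n w) (u n.+1 w))%:E)%E.
  by apply: eq_integral => w _; rewrite /g historyP // -pastE.
pose X w := (history n w, u n.+1 w).
have XE f y : X @^-1` [set (f, y)] =
    trajectory u (extend f) n `&` u n.+1 @^-1` [set y].
  rewrite -historyE; apply/seteqP; split => [w /= []//|w /= [<- <-]//].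
rewrite (@integral_finite _ T R Pr _ X (fun fy => g fy.1 fy.2)) => [||fy]; last 2 first.
- by move=> [f y]; rewrite XE; apply: measurableI => //; exact: measurable_trajectory.
- exact: F0.
transitivity (\sum_f \sum_y (g f y)%:E *
    Pr (trajectory u (extend f) n `&` u n.+1 @^-1` [set y]))%E.
  by rewrite pair_bigA; apply: eq_bigr => -[f y] _; rewrite XE.
transitivity (\int[Pr]_w
    (\sum_y p (extend (history n w) n) y * g (history n w) y)%:E)%E; last first.
  by apply: eq_integral => w _; rewrite /g !historyP // -pastE.
rewrite (@integral_finite _ T R Pr _ (history n)
  (fun f => \sum_y p (extend f n) y * g f y)) => [|f|f]; last 2 first.
- by rewrite historyE; exact: measurable_trajectory.
- by apply: sumr_ge0 => y _; apply: mulr_ge0 => //; exact: F0.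
apply: eq_bigr => f _; rewrite historyE -sumEFin ge0_sume_distrl => [|y _]; last first.
  by rewrite lee_fin; apply: mulr_ge0 => //; exact: F0.
by apply: eq_bigr => y _; rewrite trajectory_step EFinM muleA [in RHS](muleC (p _ _)%:E).
Qed.

Lemma measurable_path n (b : Omega -> seq Omega -> bool) :
  measurable [set w | b (u n w) (past (u^~ w) n)].
Proof.
rewrite (_ : [set w | _] = \bigcup_(f in [set f | b (extend f n) (past (extend f) n)])
    history n @^-1` [set f]).
  apply: fin_bigcup_measurable => [|f _]; last first.
    by rewrite historyE; exact: measurable_trajectory.
  exact: finite_finset.
have pastE w : past (u^~ w) n = past (extend (history n w)) n.
  by apply: eq_past => i ni; rewrite historyP // ltnW.
apply/seteqP; split => [w /= bw|w [f /= bf fw]].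
  by exists (history n w) => //=; rewrite historyP // -pastE.
by rewrite pastE -(historyP w (leqnn n)) fw.
Qed.

Lemma path_probability n (b : Omega -> seq Omega -> bool) :
  Pr [set w | b (u n w) (past (u^~ w) n)] =
  (path_exp p nu n (fun x s => (b x s)%:R))%:E.
Proof.
have mb := measurable_path n b.
rewrite -path_integral => [|x s]; last exact: ler0n.
rewrite -[X in Pr X]setIT -integral_indic //; apply: eq_integral => w _.
rewrite indicE; case: (boolP (b _ _)) => bw; first by rewrite mem_set.
by rewrite memNset //=; exact/negP.
Qed.

Lemma pair_freqE n w a b :
  pair_freq R u n w a b = n%:R^-1 * (pair_count a b (u n w) (past (u^~ w) n))%:R.
Proof.
congr (_ * _); elim: n => [|n IH]; first by rewrite big_ord0.
by rewrite big_ord_recr /= IH -natrD addnC.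
Qed.

Lemma initial_distribution : distribution_on nu.
Proof.
have [mu init _] := hu; split=> [x|].
  by rewrite -lee_fin -init measure_ge0.
have := path_integral 0 (F := fun _ _ => 1) (fun _ _ => ler01).
rewrite /=; under eq_bigr do rewrite mulr1.
by rewrite integral_cst // mul1e => H; apply: EFin_inj; rewrite -H; exact: probability_setT.
Qed.

End Chain.

(** * Deviation, mean square and almost sure statements for the chain *)

Section MarkovChain.
Variables (R : realType) (Omega : finType) (d : measure_display).
Variables (T : measurableType d) (Pr : probability T R).
Variables (p : Omega -> Omega -> R) (mu nu : Omega -> R) (u : nat -> T -> Omega).
Hypothesis hOmega : (2 <= #|Omega|)%N.
Hypotheses (hp : transition_matrix p) (hirr : irreducible_transition p).
Hypotheses (hmu : invariant_distribution p mu) (hu : markov_chain Pr p nu u).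
Local Notation r := (ratio_sup nu mu).

Let mu_gt0 x : 0 < mu x. Proof. exact: (invariant_gt0 hp hmu hirr). Qed.
Let p_ge0 x y : 0 <= p x y. Proof. by case: (hp x). Qed.
Let hnu : distribution_on nu. Proof. exact: (initial_distribution hp hu). Qed.

Lemma ratio_sup_le x : nu x <= r * mu x.
Proof. by rewrite -ler_pdivrMr //; exact: le_bigmax. Qed.

Lemma ratio_sup_ge1 : 1 <= r.
Proof. exact: (density_bound_ge1 hmu hnu ratio_sup_le). Qed.

Lemma pair_freq_deviation n (t : R) a b : (0 < n)%N -> 0 < t ->
  (Pr [set w | (t <= `|pair_freq R u n w a b - mu a * p a b|)%R]
   <= (2 * r * expR (- (n%:R * gamma_gap p mu * t ^+ 2) /
         (4 * Num.sqrt ((2 + 6 * gamma_gap p mu) ^+ 2 * (mu a * p a b)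
                        + t ^+ 2))))%:E)%E.
Proof.
move=> n0 t0; under eq_set do rewrite pair_freqE.
rewrite (path_probability hp hu n (fun x s =>
  t <= `|n%:R^-1 * (pair_count a b x s)%:R - mu a * p a b|)) lee_fin.
exact: (pair_freq_tail hp hmu hirr hOmega hnu ratio_sup_le).
Qed.

Lemma measurable_deviation n (t : R) a b :
  measurable [set w | (t <= `|pair_freq R u n w a b - mu a * p a b|)%R].
Proof.
under eq_set do rewrite pair_freqE.
exact: (measurable_path hu n (fun x s =>
  t <= `|n%:R^-1 * (pair_count a b x s)%:R - mu a * p a b|)).
Qed.

Lemma mx_of_limit i j : (Dmx mu *m mx_of p) i j =
  mu (enum_val i) * p (enum_val i) (enum_val j).
Proof. by rewrite mul_diag_mx !mxE. Qed.

Lemma frobenius_deviation n w : (0 < n)%N ->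
  frobenius (mx_of (pair_freq R u n w) - Dmx mu *m mx_of p) ^+ 2 =
  n%:R^-1 ^+ 2 * \sum_a \sum_b centered_count p mu a b (u n w) (past (u^~ w) n) ^+ 2.
Proof.
move=> n0; rewrite sqr_sqrtr; last first.
  by apply: sumr_ge0 => i _; apply: sumr_ge0 => j _; rewrite sqr_ge0.
have size_past : size (past (u^~ w) n) = n by elim: n {n0} => //= n ->.
rewrite mulr_sumr (reindex (@enum_val _ Omega)) /=; last exact: onW_bij (@enum_val_bij Omega).
apply: eq_bigr => i _.
rewrite mulr_sumr (reindex (@enum_val _ Omega)) /=; last exact: onW_bij (@enum_val_bij Omega).
apply: eq_bigr => j _.
rewrite mxE [X in (_ + X)]mxE mx_of_limit mxE pair_freqE /centered_count size_past -exprMn.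
congr (_ ^+ 2); field; rewrite pnatr_eq0 -lt0n //.
Qed.

(** The expectation is compared with the stationary one through [ratio_sup], then summed over
    pairs. *)
Lemma expected_frobenius n K : (0 < n)%N -> 0 <= K ->
  double_sum_bound p mu n (n%:R * K) ->
  ('E_Pr[fun w =>
     (frobenius (mx_of (pair_freq R u n w) - Dmx mu *m mx_of p) ^+ 2)%R]
   <= (r * ((1 + 2 * K) / n%:R))%:E)%E.
Proof.
move=> n0 K0 HK; rewrite unlock.
under eq_integral do rewrite frobenius_deviation //.
rewrite (path_integral hp hu n (F := fun x s =>
  n%:R^-1 ^+ 2 * \sum_a \sum_b centered_count p mu a b x s ^+ 2)); last first.
  move=> x s; rewrite mulr_ge0 ?sqr_ge0 //.
  by apply: sumr_ge0 => a _; apply: sumr_ge0 => b _; rewrite sqr_ge0.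
rewrite lee_fin path_expZ.
have n0' : 0 < n%:R :> R by rewrite ltr0n.
apply: le_trans (_ : n%:R^-1 ^+ 2 * (r * (n%:R + 2 * (n%:R * K))) <= _); last first.
  by rewrite le_eqVlt; apply/orP; left; apply/eqP; field; rewrite gt_eqF.
rewrite ler_wpM2l ?sqr_ge0 //.
apply: le_trans (path_exp_density_le p_ge0 n ratio_sup_le _) _.
  by move=> x s; apply: sumr_ge0 => a _; apply: sumr_ge0 => b _; rewrite sqr_ge0.
rewrite ler_wpM2l ?(le_trans ler01 ratio_sup_ge1) //.
rewrite path_exp_sum; under eq_bigr do rewrite path_exp_sum.
by apply: centered_count_sum => //; rewrite mulr_ge0.
Qed.

(** Borel-Cantelli: the deviation bound is geometric in [n] with ratio [q = exp (- c) < 1]. *)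
Lemma deviation_infinitely_often (t : R) a b : 0 < t ->
  Pr (lim_sup_set (fun n =>
    [set w | (t <= `|pair_freq R u n w a b - mu a * p a b|)%R])) = 0%E.
Proof.
move=> t0; apply: lim_sup_set_cvg0 => [n|]; first exact: measurable_deviation.
pose F n := [set w | (t <= `|pair_freq R u n w a b - mu a * p a b|)%R].
pose c := gamma_gap p mu * t ^+ 2 / (4 * Num.sqrt ((2 + 6 * gamma_gap p mu) ^+ 2 *
  (mu a * p a b) + t ^+ 2)).
have c0 : 0 < c.
  rewrite divr_gt0 // mulr_gt0 ?exprn_gt0 ?(gamma_gap_gt0 hp hmu hirr) //.
  rewrite sqrtr_gt0 ltr_wpDl ?exprn_gt0 // mulr_ge0 ?sqr_ge0 // mulr_ge0 //.
  exact: ltW.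
pose q := expR (- c).
have q0 : 0 < q by exact: expR_gt0.
have q1 : q < 1 by rewrite -expR0 ltr_expR oppr_lt0.
have C1 : 1 <= 2 * r by have := ratio_sup_ge1; lra.
have PF n : (Pr (F n) <= (2 * r * q ^+ n)%:E)%E.
  (* The deviation bound starts at [n = 1]; for [n = 0] the trivial bound 1 is below [2 * r]. *)
  case: n => [|n].
    rewrite expr0 mulr1; apply: le_trans (probability_le1 Pr _) _.
      exact: measurable_deviation.
    by rewrite lee_fin.
  apply: le_trans (pair_freq_deviation _ _ (ltn0Sn n) t0) _.
  rewrite lee_fin; apply: ler_wpM2l; first lra.
  rewrite /q -expRM_natr ler_expR /c le_eqVlt; apply/orP; left; apply/eqP; ring.
apply: (@le_lt_trans _ _ ((2 * r / (1 - q))%:E)%E); last exact: ltry.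
apply: lime_le; first by apply: is_cvg_nneseries => n _ _; exact: measure_ge0.
apply: nearW => n.
apply: le_trans (lee_sum _ (fun i _ => PF i)) _.
rewrite sumEFin lee_fin -mulr_sumr ler_wpM2l //; first lra.
rewrite -[leRHS]mul1r ler_pdivlMr; last by rewrite subr_gt0.
by rewrite big_mkord mulrC -opprB mulNr -subrX1 opprB gerBl exprn_ge0 // (ltW q0).
Qed.

(** Countably many tolerances [1 / k.+1] and finitely many pairs give one common null set; matrix
    balls are entrywise. *)
Lemma pair_freq_cvg :
  {ae Pr, forall w : T,
    (fun n : nat => mx_of (pair_freq R u n w)) @ \oo --> Dmx mu *m mx_of p}.
Proof.
have H (ab : Omega * Omega) (k : nat) : {ae Pr, forall w, \forall n \near \oo,
    `|pair_freq R u n w ab.1 ab.2 - mu ab.1 * p ab.1 ab.2| < k.+1%:R^-1}.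
  case: ab => a b /=.
  have k0 : 0 < k.+1%:R^-1 :> R by rewrite invr_gt0 ltr0n.
  pose F n := [set w | (k.+1%:R^-1 <= `|pair_freq R u n w a b - mu a * p a b|)%R].
  exists (lim_sup_set F); split.
  - apply: bigcapT_measurable => n; apply: bigcup_measurable => m _.
    exact: measurable_deviation.
  - exact: deviation_infinitely_often.
  move=> w /= nw n _.
  apply: contrapT => wn; apply: nw; exists n => // j /= nj.
  by rewrite ltNge; apply/negP => Fj; apply: wn; exists j.
have : {ae Pr, forall w, forall k (ab : Omega * Omega), \forall n \near \oo,
    `|pair_freq R u n w ab.1 ab.2 - mu ab.1 * p ab.1 ab.2| < k.+1%:R^-1}.
  by apply: ae_foralln => k; apply: filter_forall => ab; exact: H.
apply: filterS => w Hw; apply/cvg_ballP => e e0.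
have [k ke] : exists k, k.+1%:R^-1 < e.
  exists (Num.truncn e^-1); rewrite invf_plt ?posrE //.
  by rewrite real_truncnS_gt ?num_real.
have := filter_forall eventually_filter (Hw k); apply: filterS => n Hn; split=> // i j.
rewrite mx_of_limit mxE /ball /= distrC; apply: lt_trans ke.
exact: (Hn (enum_val i, enum_val j)).
Qed.

End MarkovChain.

Theorem theorem2p1 (R : realType) (Omega : finType) (hOmega : (2 <= #|Omega|)%N)
    (d : measure_display) (T : measurableType d) (Pr : probability T R)
    (p : Omega -> Omega -> R) (mu nu : Omega -> R) (u : nat -> T -> Omega)
    (hp : transition_matrix p) (hirr : irreducible_transition p)
    (hmu : invariant_distribution p mu)
    (hu : markov_chain Pr p nu u) :
  [/\ {ae Pr, forall w : T,
        (fun n : nat => mx_of (pair_freq R u n w)) @ \oo --> Dmx mu *m mx_of p},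
      (forall (n : nat) (t : R) (a b : Omega), (0 < n)%N -> 0 < t ->
        (Pr [set w | (t <= `|pair_freq R u n w a b - mu a * p a b|)%R]
         <= (2 * ratio_sup nu mu *
             expR (- (n%:R * gamma_gap p mu * t ^+ 2) /
                   (4 * Num.sqrt ((2 + 6 * gamma_gap p mu) ^+ 2 * (mu a * p a b)
                                  + t ^+ 2))))%:E)%E),
      (forall n : nat, (0 < n)%N ->
        ('E_Pr[fun w =>
            (frobenius (mx_of (pair_freq R u n w) - Dmx mu *m mx_of p) ^+ 2)%R]
         <= (ratio_sup nu mu)%:E *
            mine ((4 + poincare_gap p mu) / (n%:R * poincare_gap p mu))%:E
                 (if (absolute_gap p mu == 0)%R then +oo
                  else ((2 + absolute_gap p mu)
                        / (n%:R * absolute_gap p mu))%:E))%E)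
    & (reversible_chain p mu -> forall n : nat, (0 < n)%N ->
        ('E_Pr[fun w =>
            (frobenius (mx_of (pair_freq R u n w) - Dmx mu *m mx_of p) ^+ 2)%R]
         <= (ratio_sup nu mu *
             ((2 + spectral_gap p mu) / (n%:R * spectral_gap p mu)))%:E)%E)].

Proof.
have r1 := ratio_sup_ge1 hp hirr hmu hu.
have r0 : 0 <= ratio_sup nu mu by exact: le_trans ler01 r1.
have eta0 := poincare_gap_gt0 hp hmu hirr hOmega.
(* One computation for the three gaps: [c = 2] for the Poincare gap, [c = 1] for the other two. *)
have expected n (e : R) : (0 < n)%N -> 0 < e -> forall c : R, 0 <= c ->
    double_sum_bound p mu n (n%:R * (c / e)) ->
    ('E_Pr[fun w =>
        (frobenius (mx_of (pair_freq R u n w) - Dmx mu *m mx_of p) ^+ 2)%R]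
     <= (ratio_sup nu mu * ((2 * c + e) / (n%:R * e)))%:E)%E.
  move=> n0 e0 c c0 HK; have ce0 : 0 <= c / e by rewrite divr_ge0 // ltW.
  apply: le_trans (expected_frobenius hp hirr hmu hu n0 ce0 HK) _.
  rewrite lee_fin ler_wpM2l // le_eqVlt; apply/orP; left; apply/eqP.
  by field; rewrite pnatr_eq0 -lt0n n0 gt_eqF.
split.
- exact: (pair_freq_cvg hOmega hp hirr hmu hu).
- move=> n t a b; exact: (pair_freq_deviation hOmega hp hirr hmu hu).
- move=> n n0.
  have H1 : ('E_Pr[fun w =>
        (frobenius (mx_of (pair_freq R u n w) - Dmx mu *m mx_of p) ^+ 2)%R]
     <= (ratio_sup nu mu * ((4 + poincare_gap p mu) / (n%:R * poincare_gap p mu)))%:E)%E.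
    have := expected n _ n0 eta0 2 (ler0n R 2) (double_sum_poincare hp hmu hirr hOmega n).
    by rewrite -natrM.
  have [_|gap0] := eqVneq (absolute_gap p mu) 0.
    by rewrite (min_l (leey _)) -EFinM.
  have gap1 : 0 < absolute_gap p mu.
    by rewrite lt_neqAle eq_sym gap0; exact: (absolute_gap_ge0 hp hmu hirr hOmega).
  have := expected n _ n0 gap1 1 ler01 (double_sum_absolute hp hmu hirr hOmega n gap1).
  rewrite mulr1 => H2.
  by rewrite minEle; case: ifP => _; rewrite -EFinM.
- move=> rev n n0.
  have := expected n _ n0 (spectral_gap_gt0 hp hmu hirr hOmega) 1 ler01
    (double_sum_reversible hp hmu hirr hOmega n rev).
  by rewrite mulr1.
Qed.
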